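(* Let $\beta\in(0,\pi]$, and suppose that $r:(0,\beta)\times[0,\infty)\to(0,\infty)$, written as $r(\varphi,t)$, is a smooth function that is the radial polar coordinate of a curve shortening flow $\gamma$ with initially radial ends at angles $\pi$ and $\pi-\beta$, that is a polar graph for $t>0$. Then the geodesic curvature $\kappa$ and the support function $\mathcal D$ of the flow satisfy $$\kappa(\varphi,t)\le\frac{1}{2t}\,\mathcal D(\varphi,t)$$ for $t>0$ (and all $\varphi\in(0,\beta)$). For any $\beta\in(0,\pi)$, the $\beta$-wedge solution achieves equality in this inequality.
   Context: Identify $\mathbb R^2\simeq\mathbb C$, and let $*$ denote anticlockwise rotation of vectors by $\pi/2$. For a regular curve with unit tangent $\mathcal T=(\cos\psi,\sin\psi)$, $\psi$ a continuous tangent angle, the geodesic curvature is $\kappa=\psi_s$ ($s$ arc-length), the unit normal is $\nu=-{*\mathcal T}$ and the curvature vector is $\vec\kappa=-\kappa\nu$. The support function is $\mathcal D:=\langle\gamma,-\nu\rangle$. Curve shortening flow is $\langle\partial_t\gamma,\nu\rangle=-\kappa$ (tangential motion is allowed). Uniformly proper solution: let $\mathcal I\subset\mathbb R$ be an open interval and $\mathcal J=[0,T)$ or $(0,T)$ with $T\in(0,\infty]$. A map $\gamma:\mathcal I\times\mathcal J\to\mathbb R^2$ is a uniformly proper solution to curve shortening flow if (1) $\gamma$ is continuous; (2) $\gamma$ is smooth on $\mathcal I\times(0,T)$; (3) $\gamma$ is proper on $\mathcal I\times[a,b]$ for any $[a,b]\subset\mathcal J$; (4) for each $t\in\mathcal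 J$ the curve $\gamma(\cdot,t)$ is embedded; (5) $\gamma$ satisfies the curve shortening flow equation for $t\in(0,T)$. Initially radial ends: for $a\in\mathbb R$ let $L_a:=\{re^{ia}: r\ge0\}$. A curve shortening flow with initially radial ends at angles $a$ and $b$ is a uniformly proper solution $\gamma:\mathcal I\times[0,T)\to\mathbb R^2$ for which there exist $u_1<u_2$ in $\mathcal I$ such that $\gamma(u,0)\in L_a$ for $u\in\mathcal I\cap(-\infty,u_1)$ and $\gamma(u,0)\in L_b$ for $u\in\mathcal I\cap(u_2,\infty)$. Polar graphs: we use the polar angle $\varphi:=\pi-\theta$, where $\theta$ is the usual anticlockwise polar angle from the positive $x$-axis. For $t>0$ the flow is a polar graph: the whole curve is $\{r(\varphi,t)e^{i(\pi-\varphi)}:\varphi\in(0,\beta)\}$, parametrised by increasing $\varphi$; $\kappa(\varphi,t)$ and $\mathcal D(\varphi,t)$ are taken at the point $r(\varphi,t)e^{i(\pi-\varphi)}$ of the curve at time $t$. At $t=0$, $r(\cdot,0)$ parametrises the initial curve without its radial ends, i.e. the part between $\gamma(u_1,0)$ and $\gamma(u_2,0)$. $\beta$-wedge solution ($\beta\in(0,\pi)$): the curve shortening flow starting from $L_\pi\cup L_{\pi-\beta}$ (traversed in along $L_\pi$ and out along $L_{\pi-\beta}$). It scales self-similarly ($\gamma(\cdot,t)$ is $t^{1/2}$ times the curve at time $1$) and for $t>0$ is a polar graph over $\varphi\in(0,\beta)$. *)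

(* Defs.v *)
From HB Require Import structures.
From mathcomp Require Import all_boot all_order all_algebra.
From mathcomp Require Import all_classical all_reals all_analysis.
Set Implicit Arguments.
Unset Strict Implicit.
Unset Printing Implicit Defensive.
Import Order.TTheory GRing.Theory Num.Theory.
Import numFieldNormedType.Exports.
Local Open Scope classical_set_scope.
Local Open Scope ring_scope.

(** * The Euclidean plane *)

(** The library's norm on [R * R] is the sup norm, so the Euclidean one is
    defined here; the two give the same topology. *)
Definition dot (R : realType) (p q : R * R) : R := p.1 * q.1 + p.2 * q.2.
Definition enorm (R : realType) (p : R * R) : R := Num.sqrt (dot p p).

Definition rot (R : realType) (p : R * R) : R * R := (- p.2, p.1).

Definition polar (R : realType) (rho theta : R) : R * R :=
  (rho * cos theta, rho * sin theta).

Definition ray (R : realType) (a : R) : set (R * R) :=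
  [set polar rho a | rho in [set rho : R | 0 <= rho]].

(** * Smooth functions of two real variables *)

(** Meaningful for open [U]: all partial derivatives of order at most [n]
    exist and are continuous at every point of [U]. *)
Fixpoint Ck (R : realType) (V : normedModType R) (n : nat)
    (U : set (R * R)) (f : R * R -> V) : Prop :=
  (forall x, U x -> {for x, continuous f}) /\
  match n with
  | 0%N => True
  | m.+1 =>
      [/\ forall x, U x -> derivable f x (1, 0) /\ derivable f x (0, 1),
          Ck m U ('D_((1, 0) : R * R) f) &
          Ck m U ('D_((0, 1) : R * R) f)]
  end.

(** Smoothness on an arbitrary subset, by local smooth extension; for open
    [A] this is ordinary smoothness, and for [A] with boundary it is
    smoothness up to the boundary. *)
Definition smooth_on (R : realType) (V : normedModType R)
    (A : set (R * R)) (f : R * R -> V) : Prop :=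
  forall x, A x -> exists (U : set (R * R)) (g : R * R -> V),
    [/\ open U, U x, forall n, Ck n U g &
        forall y, U y -> A y -> f y = g y].

(** * Geometry of a regular plane curve *)

Definition speed (R : realType) (c : R -> R * R) (u : R) : R :=
  enorm (derive1 c u).

Definition unit_tangent (R : realType) (c : R -> R * R) (u : R) : R * R :=
  (speed c u)^-1 *: derive1 c u.

Definition unit_normal (R : realType) (c : R -> R * R) (u : R) : R * R :=
  - rot (unit_tangent c u).

Definition tangent_angle (R : realType) (c : R -> R * R) (u : R)
    (psi : R -> R) : Prop :=
  \forall v \near u, {for v, continuous psi} /\
    unit_tangent c v = (cos (psi v), sin (psi v)).

(** The arc-length derivative of a continuous tangent angle near [u]. Two
    such angles differ near [u] by a constant multiple of [2 * pi], so the
    value does not depend on which one [get] selects. *)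
Definition geodesic_curvature (R : realType) (c : R -> R * R) (u : R) : R :=
  derive1 (get [set psi : R -> R | tangent_angle c u psi]) u / speed c u.

Definition support_function (R : realType) (c : R -> R * R) (u : R) : R :=
  dot (c u) (- unit_normal c u).

(** * Uniformly proper solutions of curve shortening flow *)

Definition open_interval (R : realType) (I : set R) : Prop :=
  [/\ open I, is_interval I & I !=set0].

Definition time_slice (R : realType) (gamma : R * R -> R * R) (t : R) :
  R -> R * R := fun u => gamma (u, t).

Definition proper_on (R : realType) (A : set (R * R))
    (f : R * R -> R * R) : Prop :=
  forall K : set (R * R), compact K -> compact (A `&` f @^-1` K).

(** Topological embedding: a homeomorphism of the open set [I] onto its
    image. *)
Definition embedded_on (R : realType) (I : set R) (c : R -> R * R) : Prop :=
  [/\ {within I, continuous c}, set_inj I c &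
      forall U : set R, open U -> U `<=` I ->
        exists2 V : set (R * R), open V & c @` U = V `&` (c @` I)].

(** The initial curve need not be smooth, so regularity of the curves is
    required only at positive times, where the flow equation presupposes it. *)
Definition satisfies_csf (R : realType) (I : set R) (T : \bar R)
    (gamma : R * R -> R * R) : Prop :=
  forall u t, I u -> 0 < t -> (t%:E < T)%E ->
    derive1 (time_slice gamma t) u != 0 /\
    dot (derive1 (fun s => gamma (u, s)) t) (unit_normal (time_slice gamma t) u)
      = - geodesic_curvature (time_slice gamma t) u.

Definition closed_time (R : realType) (T : \bar R) : set R :=
  [set t | 0 <= t /\ (t%:E < T)%E].
Definition open_time (R : realType) (T : \bar R) : set R :=
  [set t | 0 < t /\ (t%:E < T)%E].

Record uniformly_proper_solution (R : realType) (I : set R) (T : \bar R)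
    (J : set R) (gamma : R * R -> R * R) : Prop := {
  ups_space : open_interval I;
  ups_time_gt0 : (0 < T)%E;
  ups_time : J = closed_time T \/ J = open_time T;
  ups_continuous : {within I `*` J, continuous gamma};
  ups_smooth : smooth_on (I `*` open_time T) gamma;
  ups_proper : forall a b : R, `[a, b] `<=` J ->
    proper_on (I `*` `[a, b]) gamma;
  ups_embedded : forall t, J t -> embedded_on I (time_slice gamma t);
  ups_csf : satisfies_csf I T gamma
}.

(** * Initially radial ends and polar graphs *)

Definition radial_ends_at (R : realType) (I : set R)
    (gamma : R * R -> R * R) (a b u1 u2 : R) : Prop :=
  [/\ I u1, I u2, u1 < u2,
      forall u, I u -> u < u1 -> ray a (gamma (u, 0)) &
      forall u, I u -> u2 < u -> ray b (gamma (u, 0))].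

Definition csf_initially_radial_ends (R : realType) (I : set R) (T : \bar R)
    (gamma : R * R -> R * R) (a b : R) : Prop :=
  uniformly_proper_solution I T (closed_time T) gamma /\
  exists u1 u2, radial_ends_at I gamma a b u1 u2.

(** The polar angle is [phi = pi - theta], so this curve runs clockwise. *)
Definition polar_curve (R : realType) (r : R * R -> R) (t : R) : R -> R * R :=
  fun phi => polar (r (phi, t)) (pi - phi).

Definition polar_graph_flow (R : realType) (beta : R) (I : set R)
    (gamma : R * R -> R * R) (r : R * R -> R) : Prop :=
  forall t, 0 < t ->
    (forall phi, 0 < phi < beta -> 0 < r (phi, t)) /\
    time_slice gamma t @` I = polar_curve r t @` `]0, beta[.

(** The initial curve leaves [ray pi] at [u1] and reaches [ray (pi - beta)]
    at [u2]; [r (_, 0)] describes only the part in between. *)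
Definition radial_coordinate_of (R : realType) (beta : R) (I : set R)
    (gamma : R * R -> R * R) (r : R * R -> R) : Prop :=
  [/\ csf_initially_radial_ends I +oo%E gamma pi (pi - beta),
      polar_graph_flow beta I gamma r &
      exists u1 u2, radial_ends_at I gamma pi (pi - beta) u1 u2 /\
        time_slice gamma 0 @` `]u1, u2[ = polar_curve r 0 @` `]0, beta[].

(** * Wedge solutions *)

Definition self_similar (R : realType) (I : set R)
    (gamma : R * R -> R * R) : Prop :=
  forall t, 0 < t ->
    time_slice gamma t @` I =
    [set Num.sqrt t *: p | p in time_slice gamma 1 @` I].

(** [r] is the radial coordinate of the solution at positive times; the
    radial ends fix the direction in which the wedge is traversed. *)
Record wedge_solution (R : realType) (beta : R) (I : set R)
    (gamma : R * R -> R * R) (r : R * R -> R) : Prop := {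
  wedge_flow : csf_initially_radial_ends I +oo%E gamma pi (pi - beta);
  wedge_initial :
    time_slice gamma 0 @` I = ray (pi : R) `|` ray (pi - beta);
  wedge_self_similar : self_similar I gamma;
  wedge_polar : polar_graph_flow beta I gamma r
}.

(* Main.v *)
(* Idea. Write [w = r ^+ 2] and [A = atan (r_p / r)] for the angle between the
   normal and the radial direction. The curvature and the support function are
   [r * r_t / s] and [r ^+ 2 / s] with [s] the speed, and the flow reads
   [w_t / 2 = A_p - 1]; so the inequality says that [w (p, t) / t] decreases in
   [t], that is [w_mu <= w] for every rescaled flow
   [w_mu (p, t) = w (p, mu * t) / mu] with [mu > 1].

   The integral of [(w_mu - w)_+ / 2] over [p] changes only through the ends:
   inside, [atan] being increasing, the flux [A_mu - A] has the favourable sign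
   on the boundary of [w_mu > w]. At the end [p = 0] the inflow is at most
   [A + pi / 2] since [A_mu >= - pi / 2]. The entropy
   [(1 + w) * ln (1 + w) - w] loses [ln (1 + w) * (A + pi / 2)] there, up to
   bounded terms, and by properness [w] tends to infinity at the ends; so a small
   multiple of the entropy absorbs the inflow. Initially [w_mu < w], hence
   [w_mu <= w] for all times.

   For a self-similar solution [w / t] is constant in [t], which is the equality
   case; the radius is differentiable because the support function satisfies a
   linear differential equation along the curve and so cannot vanish. *)
Require Import Defs.
From HB Require Import structures.
From mathcomp Require Import all_boot all_order all_algebra.
From mathcomp Require Import all_classical all_reals all_analysis.
From mathcomp Require Import ring lra.
Import Order.TTheory GRing.Theory Num.Theory.
Import numFieldNormedType.Exports.
Local Open Scope classical_set_scope.
Local Open Scope ring_scope.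

(** * Calculus *)

Section calculus.
Context {R : realType}.
Implicit Types (f g : R -> R) (x a b : R).

(** No maximum principle applies directly to [w_mu - w]: the radius is infinite at both ends and
    nothing is known about its derivatives there. The flux, however, is a difference of arctangents,
    so an end lets in at most [pi] per unit time whatever happens there; hence the integral form, a
    comparison of areas. Two statements fail to be uniform: the initial inequality holds uniformly
    only on compact ranges of angles, and properness makes the radius large at the ends only away
    from time 0. So the integral runs over [[d, beta - d]] from a time [t0 > 0], and until a small
    time [a] the ends are left open, at a cost of at most [2 * pi * a]. The weight [sg] of the
    entropy, then [a], [d], [t0] and the regularisation [e] are fixed in this order, each after
    those it depends on. The slope of the entropy must tend to infinity, but so slowly that the
    interior terms it creates stay bounded below; [ln (1 + w)] achieves both. The wedge poses
    another difficulty: its radius is given only by a description of the curves as sets, so its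
    regularity has to be derived. *)

Lemma is_derive_addf f g x a b : is_derive x 1 f a -> is_derive x 1 g b ->
  is_derive x 1 (fun y => f y + g y) (a + b).
Proof. move=> df dg; exact: (@is_deriveD _ _ _ f g). Qed.

Lemma is_derive_oppf f x a : is_derive x 1 f a ->
  is_derive x 1 (fun y => - f y) (- a).
Proof. move=> df; exact: (@is_deriveN _ _ _ f). Qed.

Lemma is_derive_mulf f g x a b : is_derive x 1 f a -> is_derive x 1 g b ->
  is_derive x 1 (fun y => f y * g y) (f x * b + g x * a).
Proof. move=> df dg; exact: (@is_deriveM _ _ f g). Qed.

Lemma is_derive_cstf x a : is_derive x 1 (fun _ : R => a) 0.
Proof. exact: is_derive_cst. Qed.

Lemma is_derive_idf x : is_derive x 1 (fun y : R => y) 1.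
Proof. exact: is_derive_id. Qed.

Lemma is_derive_invf f x a : f x != 0 -> is_derive x 1 f a ->
  is_derive x 1 (fun y => (f y)^-1) (- (f x) ^- 2 * a).
Proof. move=> fx df; exact: is_deriveV. Qed.

Lemma is_derive_exprf f n x a : is_derive x 1 f a ->
  is_derive x 1 (fun y => f y ^+ n) (n%:R * f x ^+ n.-1 * a).
Proof.
move=> df; rewrite (_ : (fun y => f y ^+ n) = f ^+ n); first exact: is_deriveX.
by apply/funext => y; rewrite !fctE.
Qed.

Lemma is_derive_compf f g x a b : is_derive (g x) 1 f a -> is_derive x 1 g b ->
  is_derive x 1 (fun y => f (g y)) (a * b).
Proof. move=> df dg; exact: (@is_derive1_comp _ f g). Qed.

Lemma is_derive_continuous f x a : is_derive x 1 f a -> {for x, continuous f}.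
Proof.
by move=> [df _]; apply/differentiable_continuous/derivable1_diffP.
Qed.

End calculus.

(** The goal is matched on the shape of its lambda term, which is why the differentiation rules
    above are restated for explicit lambda terms. [derive_tac] leaves the derivative to unification
    and returns the side conditions and the identity with the announced value. *)
Ltac derive_step :=
  match goal with
  | |- is_derive _ _ (fun _ => ?c) _ => exact: is_derive_cstf
  | |- is_derive _ _ (fun y => y) _ => exact: is_derive_idf
  | |- is_derive _ _ (fun y => @?f y + @?g y) _ =>
      notypeclasses refine (@is_derive_addf _ f g _ _ _ _ _)
  | |- is_derive _ _ (fun y => - @?f y) _ => notypeclasses refine (@is_derive_oppf _ f _ _ _)
  | |- is_derive _ _ (fun y => @?f y * @?g y) _ =>
      notypeclasses refine (@is_derive_mulf _ f g _ _ _ _ _)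
  | |- is_derive _ _ (fun y => (@?f y)^-1) _ =>
      notypeclasses refine (@is_derive_invf _ f _ _ _ _)
  | |- is_derive _ _ (fun y => (@?f y) ^+ ?n) _ =>
      notypeclasses refine (@is_derive_exprf _ f n _ _ _)
  | |- is_derive _ _ (fun y => atan (@?f y)) _ =>
      notypeclasses refine (@is_derive_compf _ atan f _ _ _ (is_derive1_atan _) _)
  | |- is_derive _ _ (fun y => cos (@?f y)) _ =>
      notypeclasses refine (@is_derive_compf _ cos f _ _ _ (is_derive_cos _) _)
  | |- is_derive _ _ (fun y => sin (@?f y)) _ =>
      notypeclasses refine (@is_derive_compf _ sin f _ _ _ (is_derive_sin _) _)
  | |- is_derive _ _ (fun y => Num.sqrt (@?f y)) _ =>
      notypeclasses refine (@is_derive_compf _ Num.sqrt f _ _ _ (is_derive1_sqrt _) _)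
  | |- is_derive _ _ (fun y => ln (@?f y)) _ =>
      notypeclasses refine (@is_derive_compf _ (@ln _) f _ _ _ (is_derive1_ln _) _)
  end.

Ltac derive_tac :=
  match goal with
  | |- is_derive ?x ?v ?f ?d =>
      notypeclasses refine (@is_derive_eq _ _ _ f x v d _ _ _);
      [repeat (cbv beta; first [eassumption | derive_step]) | rewrite /= ?mulr1]
  end.

Section continuity.
Context {R : realType} {T : topologicalType}.
Implicit Types (f g : T -> R) (x : T).

Lemma continuous_addf f g x : {for x, continuous f} -> {for x, continuous g} ->
  {for x, continuous (fun y => f y + g y)}.
Proof. by move=> cf cg; exact: (@continuousD R _ T f g x cf cg). Qed.

Lemma continuous_oppf f x : {for x, continuous f} ->
  {for x, continuous (fun y => - f y)}.
Proof. by move=> cf; exact: (@continuousN R _ T f x cf). Qed.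

Lemma continuous_mulf f g x : {for x, continuous f} -> {for x, continuous g} ->
  {for x, continuous (fun y => f y * g y)}.
Proof. by move=> cf cg; exact: (@continuousM R T f g x cf cg). Qed.

Lemma continuous_invf f x : f x != 0 -> {for x, continuous f} ->
  {for x, continuous (fun y => (f y)^-1)}.
Proof. by move=> fx cf; exact: (@continuousV R T f x fx cf). Qed.

Lemma continuous_cstf (a : R) x : {for x, continuous (fun _ : T => a)}.
Proof. exact: cst_continuous. Qed.

Lemma continuous_compf (U V : topologicalType) (f : U -> V) (g : T -> U) x :
  {for g x, continuous f} -> {for x, continuous g} ->
  {for x, continuous (fun y => f (g y))}.
Proof. by move=> cf cg; exact: (continuous_comp cg cf). Qed.

Lemma continuous_pairf (U V : topologicalType) (f : T -> U) (g : T -> V) x :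
  {for x, continuous f} -> {for x, continuous g} ->
  {for x, continuous (fun y => (f y, g y))}.
Proof. by move=> cf cg; exact: (cvg_pair cf cg). Qed.

End continuity.

Lemma continuous_fstf {U V : topologicalType} (x : U * V) :
  {for x, continuous (fun y : U * V => y.1)}.
Proof. exact: cvg_fst. Qed.

Lemma continuous_sndf {U V : topologicalType} (x : U * V) :
  {for x, continuous (fun y : U * V => y.2)}.
Proof. exact: cvg_snd. Qed.

Lemma continuous_idf {U : topologicalType} (x : U) :
  {for x, continuous (fun y : U => y)}.
Proof. by []. Qed.

Ltac cont_step :=
  match goal with
  | |- {for _, continuous (fun _ => ?c)} => exact: continuous_cstf
  | |- {for _, continuous (fun y => y)} => exact: continuous_idf
  | |- {for _, continuous (fun y => y.1)} => exact: continuous_fstf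
  | |- {for _, continuous (fun y => y.2)} => exact: continuous_sndf
  | |- {for _, continuous (fun y => (@?f y, @?g y))} =>
      notypeclasses refine (@continuous_pairf _ _ _ f g _ _ _)
  | |- {for _, continuous (fun y => @?f y + @?g y)} =>
      notypeclasses refine (@continuous_addf _ _ f g _ _ _)
  | |- {for _, continuous (fun y => - @?f y)} =>
      notypeclasses refine (@continuous_oppf _ _ f _ _)
  | |- {for _, continuous (fun y => @?f y * @?g y)} =>
      notypeclasses refine (@continuous_mulf _ _ f g _ _ _)
  | |- {for _, continuous (fun y => (@?f y)^-1)} =>
      notypeclasses refine (@continuous_invf _ _ f _ _ _)
  | |- {for _, continuous (fun y => ?g (@?f y))} =>
      notypeclasses refine (@continuous_compf _ _ _ g f _ _ _)
  end.

Ltac cont_tac := repeat (cbv beta; first [eassumption | cont_step]).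

Section mean_value.
Context {R : realType}.

Lemma mean_value (f df : R -> R) (a b : R) : a <= b ->
  (forall x, a <= x <= b -> is_derive x 1 f (df x)) ->
  exists2 c, a <= c <= b & f b - f a = df c * (b - a).
Proof.
move=> ab dfab.
have [||c cab E] := @MVT_segment _ f df a b ab.
  by move=> x; rewrite in_itv/= => /andP[/ltW ax /ltW xb]; apply: dfab; rewrite ax.
- apply: derivable_within_continuous => x; rewrite in_itv/= => xab.
  by have [] := dfab _ xab.
- by exists c => //; move: cab; rewrite in_itv.
Qed.

Lemma mean_value_ge (f df : R -> R) (a b k : R) : a <= b ->
  (forall x, a <= x <= b -> is_derive x 1 f (df x)) ->
  (forall x, a <= x <= b -> k <= df x) -> k * (b - a) <= f b - f a.
Proof.
move=> ab d k_le; have [c cab ->] := mean_value _ _ _ _ ab d.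
by apply: ler_wpM2r; [rewrite subr_ge0|exact: k_le].
Qed.

Lemma mean_value_le (f df : R -> R) (a b k : R) : a <= b ->
  (forall x, a <= x <= b -> is_derive x 1 f (df x)) ->
  (forall x, a <= x <= b -> df x <= k) -> f b - f a <= k * (b - a).
Proof.
move=> ab d k_le; have [c cab ->] := mean_value _ _ _ _ ab d.
by apply: ler_wpM2r; [rewrite subr_ge0|exact: k_le].
Qed.

End mean_value.

Lemma continuous_within_itv {R : realType} (f : R -> R) (a b : R) :
  (forall x, a <= x <= b -> {for x, continuous f}) ->
  {within `[a, b], continuous f}.
Proof.
move=> cf; apply: continuous_in_subspaceT => x; rewrite inE/= in_itv/=.
exact: cf.
Qed.

(** Integrals occur only here: [X] and [Y] are the integrals of [U] and [Ut] from [a] to [p],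
    differentiated by the fundamental theorem of calculus and under the integral sign, with the
    constant [M] as dominating function. Later arguments see only derivatives and the mean value
    theorem. *)
Lemma parametric_primitive {R : realType} (U Ut : R -> R -> R)
    (a b t0 t1 M : R) :
  (forall p t, a <= p <= b -> t0 < t < t1 ->
    [/\ is_derive t 1 (U p) (Ut p t), {for p, continuous (U^~ t)},
        {for p, continuous (Ut^~ t)} & `|Ut p t| <= M]) ->
  exists X Y : R -> R -> R, forall p t, a < p < b -> t0 < t < t1 ->
    [/\ is_derive p 1 (X^~ t) (U p t), is_derive p 1 (Y^~ t) (Ut p t) &
        is_derive t 1 (X p) (Y p t)].
Proof.
move=> H; pose mu := @lebesgue_measure R.
exists (fun p t => \int[mu]_(q in `[a, p]) U q t)%R.
exists (fun p t => \int[mu]_(q in `[a, p]) Ut q t)%R.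
move=> p t /andP[ap pb] tI.
have intU s c : t0 < s < t1 -> c <= b -> mu.-integrable `[a, c] (EFin \o U^~ s).
  move=> sI cb; apply: continuous_compact_integrable; first exact: segment_compact.
  apply: continuous_within_itv => x /andP[ax xc].
  by have [] := H x s _ sI; rewrite // ax (le_trans xc cb).
have intUt s c : t0 < s < t1 -> c <= b -> mu.-integrable `[a, c] (EFin \o Ut^~ s).
  move=> sI cb; apply: continuous_compact_integrable; first exact: segment_compact.
  apply: continuous_within_itv => x /andP[ax xc].
  by have [] := H x s _ sI; rewrite // ax (le_trans xc cb).
have pI : a <= p <= b by rewrite !ltW.
have [_ cU cUt _] := H p t pI tI.
split.
- have [dX eX] := continuous_FTC1_closed pb (intU t b tI (lexx _)) ap cU.
  by apply: DeriveDef; [exact: dX|rewrite -derive1E eX].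
- have [dX eX] := continuous_FTC1_closed pb (intUt t b tI (lexx _)) ap cUt.
  by apply: DeriveDef; [exact: dX|rewrite -derive1E eX].
- have mB : measurable `[a, p] by exact: measurable_itv.
  have dq x q : `]t0, t1[%classic x -> `[a, p]%classic q -> is_derive x 1 (U q) (Ut q x).
    rewrite /= !in_itv/= => xI /andP[aq qp].
    by have [] := H q x _ xI; rewrite // aq (le_trans qp (ltW pb)).
  have h1 x : `]t0, t1[%classic x -> mu.-integrable `[a, p] (EFin \o U^~ x).
    by rewrite /= in_itv/= => xI; apply: intU => //; exact: ltW.
  have h2 x q : `]t0, t1[%classic x -> `[a, p]%classic q -> derivable (U q) x 1.
    by move=> xI qI; have [] := dq _ _ xI qI.
  have M0 : 0 <= M by have [_ _ _] := H p t pI tI; exact/le_trans/normr_ge0.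
  have e1 x q : `]t0, t1[%classic x -> `[a, p]%classic q -> partial1of2 (fun x q => U q x) x q = Ut q x.
    move=> xI qI; rewrite partial1of2E.
    by have [_ <-] := dq _ _ xI qI.
  have h3 : mu.-integrable `[a, p] (EFin \o (fun=> M)).
    apply: continuous_compact_integrable; first exact: segment_compact.
    by apply: continuous_within_itv => x _; exact: cst_continuous.
  have h4 x q : `]t0, t1[%classic x -> `[a, p]%classic q ->
      `|partial1of2 (fun x q => U q x) x q| <= M.
    move=> xI qI; rewrite e1//; move: xI qI.
    rewrite /= !in_itv/= => xI /andP[aq qp].
    by have [] := H q x _ xI; rewrite // aq (le_trans qp (ltW pb)).
  have It : `]t0, t1[%classic t by rewrite /= in_itv.
  have d := @derivable_under_integral R _ _ mu (fun x q => U q x) _ mB t t0 t1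
    It h1 h2 (fun=> M) (fun=> M0) h3 h4.
  have e := @differentiation_under_integral R _ _ mu (fun x q => U q x) _ mB t t0 t1
    It h1 h2 (fun=> M) (fun=> M0) h3 h4.
  apply: DeriveDef => //; rewrite -derive1E e.
  by apply: eq_Rintegral => q; rewrite inE => qI; exact: e1.
Qed.

(** * Elementary inequalities and a regularised positive part *)

Section elementary.
Context {R : realType}.
Implicit Types p q s e : R.

(** The difference of the two sides vanishes at 0 and has derivative [x * sin x]. *)
Lemma mulr_cos_le_sin (y : R) : 0 <= y <= pi -> y * cos y <= sin y.
Proof.
move=> /andP[y0 ypi]; pose g (x : R) := sin x - x * cos x.
have : 0 * (y - 0) <= g y - g 0.
  apply: (@mean_value_ge _ g (fun x => x * sin x)) => // x /andP[x0 xy].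
    by rewrite /g; (derive_tac; ring).
  by rewrite mulr_ge0// sin_ge0_pi// x0 (le_trans xy).
by rewrite /g sin0 cos0; lra.
Qed.

(** With [y = atan p + pi / 2] in []0, pi[] one has [p = - cos y / sin y], so this is the previous
    inequality divided by [sin y]. It bounds the interior terms of the entropy however large the
    slope [p] is. *)
Lemma mulr_atanDpihalf_ge p : -1 <= p * (atan p + pi / 2).
Proof.
set a := atan p; have c0 : 0 < cos a.
  by apply: cos_gt0_pihalf; rewrite atan_gtNpi2 atan_ltpi2.
have -> : p = sin a / cos a by rewrite -[LHS]atanK.
have aI : - (pi / 2) < a < pi / 2 by rewrite atan_gtNpi2 atan_ltpi2.
have := @mulr_cos_le_sin (a + pi / 2).
rewrite cosDpihalf sinDpihalf => /(_ ltac:(lra)) H.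
by rewrite mulrAC ler_pdivlMr//; lra.
Qed.

Lemma mulr_atanBpihalf_ge p : -1 <= p * (atan p - pi / 2).
Proof. by have := mulr_atanDpihalf_ge (- p); rewrite atanN; lra. Qed.

Lemma atan_mono_prod p q : 0 <= (p - q) * (atan p - atan q).
Proof.
have [pq|/ltW qp] := leP p q.
  by rewrite -mulrNN mulr_ge0// opprB subr_ge0 ?le_atan.
by rewrite mulr_ge0// subr_ge0 ?le_atan.
Qed.

(** The witness is [(s + sqrt (s ^+ 2 + e ^+ 2)) / 2]. Its convexity, [0 <= eta'], gives the
    interior flux term its sign; the true positive part satisfies [N s = s * eta s] away from 0, and
    here the defect is [e ^+ 2 / (2 * S s) <= e / 2]. *)
Lemma smooth_positive_part e : 0 < e ->
  exists N eta eta' : R -> R, forall s,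
    [/\ is_derive s 1 N (eta s), is_derive s 1 eta (eta' s),
        [/\ 0 <= eta' s, 0 <= eta s, eta s <= 1, 0 <= N s & s <= N s],
        `|N s - s * eta s| <= e & (s <= 0 -> N s <= e)].
Proof.
move=> e0; pose S s := Num.sqrt (s ^+ 2 + e ^+ 2).
exists (fun s => (s + S s) / 2), (fun s => (1 + s / S s) / 2).
exists (fun s => e ^+ 2 / S s ^+ 3 / 2) => s.
have e20 : 0 < e ^+ 2 by rewrite exprn_gt0.
have q0 : 0 < s ^+ 2 + e ^+ 2 by rewrite ltr_wpDl// sqr_ge0.
have S0 : 0 < S s by rewrite sqrtr_gt0.
have SE : S s ^+ 2 = s ^+ 2 + e ^+ 2 by rewrite sqr_sqrtr// ltW.
have eS : e <= S s by rewrite -ler_sqr ?nnegrE ?(ltW e0) ?(ltW S0)// SE lerDr sqr_ge0.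
have sS : `|s| <= S s by rewrite -sqrtr_sqr ler_sqrt ?lerDl//; lra.
move: (sS); rewrite ler_norml => /andP[sS1 sS2].
have S0' : S s != 0 by rewrite gt_eqF.
have dS : is_derive s 1 S (s / S s).
  rewrite /S; derive_tac => //.
  by rewrite -/(S s) /=; field.
have rr : -1 <= s / S s <= 1.
  by rewrite ler_pdivlMr// ler_pdivrMr//; apply/andP; split; lra.
split.
- by derive_tac; ring.
- derive_tac => //.
  have -> : e ^+ 2 = S s ^+ 2 - s ^+ 2 by rewrite SE; ring.
  by field.
- split; [|lra|lra|lra|lra].
  by rewrite !divr_ge0// ?exprn_ge0// ltW.
- have -> : (s + S s) / 2 - s * ((1 + s / S s) / 2) = e ^+ 2 / S s / 2.
    have -> : e ^+ 2 = S s ^+ 2 - s ^+ 2 by rewrite SE; ring.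
    by field.
  rewrite ger0_norm ?divr_ge0// ?(ltW e20) ?(ltW S0)//.
  have : e ^+ 2 / S s <= e by rewrite ler_pdivrMr// expr2 ler_wpM2l// ltW.
  by lra.
- move=> s0; have : (S s + s) * (S s - s) = e ^+ 2.
    have -> : e ^+ 2 = S s ^+ 2 - s ^+ 2 by rewrite SE; ring.
    by ring.
  by nra.
Qed.

End elementary.

Lemma rectangle_bound {R : realType} (f : R * R -> R) (a b c d : R) :
  (forall p t, a <= p <= b -> c <= t <= d -> {for (p, t), continuous f}) ->
  exists2 M, 0 < M & forall p t, a <= p <= b -> c <= t <= d -> `|f (p, t)| <= M.
Proof.
move=> cf.
have cK : compact (`[a, b]%classic `*` `[c, d]%classic).
  by apply: compact_setX; exact: segment_compact.
have cont : {within `[a, b]%classic `*` `[c, d]%classic, continuous f}.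
  apply: continuous_in_subspaceT => -[p t]; rewrite inE/= => -[].
  by rewrite !in_itv/=; exact: cf.
have [M [_ HM]] := compact_bounded (continuous_compact cont cK).
exists (`|M| + 1) => [|p t pI tI]; first by rewrite ltr_wpDl.
apply: (HM (`|M| + 1)); first by rewrite (le_lt_trans (ler_norm M))// ltrDl.
by exists (p, t) => //; split; rewrite /= in_itv.
Qed.

(** * Contraction of rescaled flows *)

(** Since [wp = 2 * r * r_p], the quotient is [r_p / r]. *)
Definition radial_angle {R : realType} (w wp : R * R -> R) (q : R * R) : R :=
  atan (wp q / (2 * w q)).

(* [w] is the squared radius in the polar angle [p] and time [t], [wt] and [wp]
   are its partial derivatives, and [srf_eqn] is the flow equation
   [w_t / 2 = A_p - 1], where [A] is [radial_angle]. *)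
Record squared_radius_flow {R : realType} (beta : R) (w wt wp : R * R -> R) : Prop := {
  srf_gt0 : forall p t : R, 0 < p < beta -> 0 < t -> 0 < w (p, t);
  srf_time : forall p t : R, 0 < p < beta -> 0 < t ->
    is_derive t 1 (fun s => w (p, s)) (wt (p, t));
  srf_space : forall p t : R, 0 < p < beta -> 0 < t ->
    is_derive p 1 (fun q => w (q, t)) (wp (p, t));
  srf_eqn : forall p t : R, 0 < p < beta -> 0 < t ->
    is_derive p 1 (fun q => radial_angle w wp (q, t)) (wt (p, t) / 2 + 1);
  srf_cont : forall p t : R, 0 < p < beta -> 0 < t -> {for (p, t), continuous w};
  srf_time_cont : forall p t : R, 0 < p < beta -> 0 < t ->
    {for (p, t), continuous wt} }.

Arguments srf_gt0 {R beta w wt wp} _ {p t}.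
Arguments srf_time {R beta w wt wp} _ {p t}.
Arguments srf_space {R beta w wt wp} _ {p t}.
Arguments srf_eqn {R beta w wt wp} _ {p t}.
Arguments srf_cont {R beta w wt wp} _ {p t}.
Arguments srf_time_cont {R beta w wt wp} _ {p t}.

Section entropy.
Context {R : realType}.
Implicit Types x y : R.

(** The primitive of [ln (1 + x)] that vanishes at 0. Its slope is unbounded, as the ends require,
    while [x] times its second derivative, [x / (1 + x)], stays in [[0, 1]], as the interior
    requires. *)
Definition entropy (x : R) : R := (1 + x) * ln (1 + x) - x.

Lemma is_derive_entropy x : 0 <= x -> is_derive x 1 entropy (ln (1 + x)).
Proof.
move=> x0; have x1 : 0 < 1 + x by rewrite ltr_wpDr.
by rewrite /entropy; derive_tac => //; field; rewrite gt_eqF.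
Qed.

Lemma entropy_le x y : 0 <= x -> x <= y -> entropy x <= entropy y.
Proof.
move=> x0 xy; rewrite -subr_ge0 -[leLHS](mul0r (y - x)).
apply: (@mean_value_ge _ entropy (fun x => ln (1 + x))) => // z /andP[xz _].
  exact/is_derive_entropy/(le_trans x0 xz).
by rewrite ln_ge0// lerDl (le_trans x0 xz).
Qed.

Lemma entropy_ge0 x : 0 <= x -> 0 <= entropy x.
Proof.
move=> x0; apply: le_trans (entropy_le _ _ (lexx 0) x0).
by rewrite /entropy addr0 ln1 mulr0 subrr.
Qed.

End entropy.

Lemma itv_shrink {R : realType} (d b p : R) :
  0 < d -> d <= p <= b - d -> 0 < p < b.
Proof. by move=> d0 /andP[p1 p2]; apply/andP; split; lra. Qed.

(** * Integral estimate for a flow and its rescaling *)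

Section contraction.
Context {R : realType} (beta : R) (w wt wp : R * R -> R).
Hypothesis flow : squared_radius_flow beta w wt wp.
Variables (mu sg e : R) (N eta eta' : R -> R).
Hypotheses (mu_gt0 : 0 < mu) (sg_ge0 : 0 <= sg).
Hypothesis HN : forall s : R,
  [/\ is_derive s 1 N (eta s), is_derive s 1 eta (eta' s),
      [/\ 0 <= eta' s, 0 <= eta s, eta s <= 1, 0 <= N s & s <= N s],
      `|N s - s * eta s| <= e & (s <= 0 -> N s <= e)].

Let A q := radial_angle w wp q.

(* With [w_mu (p, t) = w (p, mu * t) / mu] the rescaled flow, [excess] is
   [w_mu / w - 1] and [density] is half of a regularised positive part of
   [w_mu - w], plus an entropy whose flux dominates the flux of the first term
   at an end where [sg * ln (1 + w) >= 1]. *)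
Definition excess (q : R * R) : R := w (q.1, mu * q.2) / mu / w q - 1.

Definition density (q : R * R) : R :=
  w q * N (excess q) / 2 + sg * (entropy (w q) / 2).

Definition density_rate (q : R * R) : R :=
  (wt q * N (excess q) +
   eta (excess q) * (wt (q.1, mu * q.2) - (1 + excess q) * wt q)) / 2 +
  sg * (ln (1 + w q) * wt q / 2).

Lemma excess_time (p t : R) : 0 < p < beta -> 0 < t ->
  is_derive t 1 (fun s => excess (p, s))
    ((wt (p, mu * t) - (1 + excess (p, t)) * wt (p, t)) / w (p, t)).
Proof.
move=> pI t0; have w0 := srf_gt0 flow pI t0.
have mt0 : 0 < mu * t by rewrite mulr_gt0.
have d1 := srf_time flow pI t0.
have d2 : is_derive t 1 (fun s => w (p, mu * s)) (mu * wt (p, mu * t)).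
  have := @is_derive_compf _ (fun s => w (p, s)) (fun s => mu * s) t _ _
    (srf_time flow pI mt0).
  by move=> /(_ mu) H; rewrite mulrC; apply: H; derive_tac; rewrite mulr0 addr0.
rewrite /excess /=; derive_tac; first by rewrite gt_eqF.
by field; rewrite !gt_eqF.
Qed.

Lemma density_time (p t : R) : 0 < p < beta -> 0 < t ->
  is_derive t 1 (fun s => density (p, s)) (density_rate (p, t)).
Proof.
move=> pI t0; have w0 := srf_gt0 flow pI t0.
have d1 := srf_time flow pI t0.
have d2 := excess_time p t pI t0.
have [dN _ _ _ _] := HN (excess (p, t)).
have d3 := @is_derive_compf _ N (fun s => excess (p, s)) t _ _ dN d2.
rewrite /density /density_rate /entropy /=; derive_tac.
  by rewrite addr_gt0.
by field; rewrite !gt_eqF// addr_gt0.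
Qed.

Lemma excess_space (p t : R) : 0 < p < beta -> 0 < t ->
  is_derive p 1 (fun q => excess (q, t))
    (2 * (w (p, mu * t) / (mu * w (p, t))) *
     (wp (p, mu * t) / (2 * w (p, mu * t)) - wp (p, t) / (2 * w (p, t)))).
Proof.
move=> pI t0; have w0 := srf_gt0 flow pI t0.
have mt0 : 0 < mu * t by rewrite mulr_gt0.
have w1 := srf_gt0 flow pI mt0.
have d1 := srf_space flow pI t0.
have d2 := srf_space flow pI mt0.
rewrite /excess /=; derive_tac; first by rewrite gt_eqF.
by field; rewrite !gt_eqF.
Qed.

(* Take [c = 1] near the end [p = 0] and [c = -1] near [p = beta]: the shifted
   angle [A + c * (pi / 2)] then has the sign which makes the entropy flux
   through that end a loss. *)
Definition flux (c : R) (q : R * R) : R :=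
  eta (excess q) * (A (q.1, mu * q.2) - A q) +
  sg * (ln (1 + w q) * (A q + c * (pi / 2))).

(** By the flow equation, the rate is the space derivative of the flux minus three terms, plus the
    defect of the regularisation. The first term, [eta'] times the slope of [excess] times
    [A_mu - A], is nonnegative because that slope has the sign of the difference of the tangents of
    the two angles. The second comes from differentiating [ln (1 + w)] and is at least [-2 * sg];
    the third, [sg * ln (1 + w)], is nonnegative. *)
Lemma flux_space (c C p t : R) : (c == 1) || (c == -1) ->
  0 < p < beta -> 0 < t -> `|wt (p, t)| <= C ->
  exists2 d, is_derive p 1 (fun q => flux c (q, t)) d &
    density_rate (p, t) <= d + (C * e / 2 + 2 * sg).
Proof.
move=> c1 pI t0 wtC; have w0 := srf_gt0 flow pI t0.
have mt0 : 0 < mu * t by rewrite mulr_gt0.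
have w1 := srf_gt0 flow pI mt0.
have d1 := srf_space flow pI t0.
have d2 := excess_space p t pI t0.
have d3 := srf_eqn flow pI t0.
have d4 := srf_eqn flow pI mt0.
have [_ deta [eta'0 eta0 eta1 _ _] Ne _] := HN (excess (p, t)).
have d5 := @is_derive_compf _ eta (fun q => excess (q, t)) p _ _ deta d2.
have w10 : 0 < 1 + w (p, t) by rewrite addr_gt0.
eexists.
  by rewrite /flux /A /=; derive_tac; reflexivity.
rewrite /density_rate /= -!/(A _) !(add0r, addr0, mulr0).
set p1 := wp (p, mu * t) / (2 * w (p, mu * t)).
set p2 := wp (p, t) / (2 * w (p, t)).
have A1 : A (p, mu * t) = atan p1 by [].
have A2 : A (p, t) = atan p2 by [].
set ex := excess (p, t) in Ne eta0 eta1 eta'0 *.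
have h1 : 0 <= (A (p, mu * t) - A (p, t)) *
    (eta' ex * (2 * (w (p, mu * t) / (mu * w (p, t))) * (p1 - p2))).
  have := atan_mono_prod p1 p2; rewrite -A1 -A2 => h.
  rewrite (_ : _ * _ = eta' ex * (2 * (w (p, mu * t) / (mu * w (p, t)))) *
    ((p1 - p2) * (A (p, mu * t) - A (p, t)))); last by ring.
  apply: mulr_ge0 => //; apply: mulr_ge0 => //; apply: mulr_ge0 => //.
  by rewrite ltW// divr_gt0// mulr_gt0.
have h2 : wt (p, t) * (N ex - ex * eta ex) <= C * e.
  by rewrite (le_trans (ler_norm _))// normrM ler_pM.
(* The product equals [2 * k] times [p2 * (A + c * (pi / 2))], with [k = w / (1 + w)] in [[0, 1]];
   the second factor is at least [-1] for every slope [p2]. *)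
have h3 : - 2 <= (A (p, t) + c * (pi / 2)) * ((1 + w (p, t))^-1 * wp (p, t)).
  pose k := w (p, t) / (1 + w (p, t)).
  have k1 : k <= 1 by rewrite ler_pdivrMr// mul1r lerDr.
  have k0 : 0 <= k by rewrite divr_ge0// ltW.
  have -> : (1 + w (p, t))^-1 * wp (p, t) = 2 * k * p2.
    by rewrite /k /p2; field; rewrite !gt_eqF.
  have : -1 <= p2 * (A (p, t) + c * (pi / 2)).
    rewrite A2; case/orP : c1 => /eqP ->.
      by rewrite mul1r mulr_atanDpihalf_ge.
    by rewrite mulN1r mulr_atanBpihalf_ge.
  by set x := p2 * _ => hx; rewrite (_ : _ * _ = 2 * (k * x)); [nra|rewrite /x; ring].
have h4 : 0 <= ln (1 + w (p, t)) by rewrite ln_ge0// lerDl ltW.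
have := mulr_ge0 sg_ge0 h4; have := ler_wpM2l sg_ge0 h3.
move: h1 h2; rewrite -/p2 -/p1.
lra.
Qed.

Lemma density_rate_cont (p t : R) : 0 < p < beta -> 0 < t ->
  {for (p, t), continuous density_rate}.
Proof.
move=> pI t0; have w0 := srf_gt0 flow pI t0.
have mt0 : 0 < mu * t by rewrite mulr_gt0.
have cw := srf_cont flow pI t0; have cwt := srf_time_cont flow pI t0.
have cwm : {for (p, t), continuous (fun q => w (q.1, mu * q.2))}.
  by cont_tac; exact: (srf_cont flow pI mt0).
have cwtm : {for (p, t), continuous (fun q => wt (q.1, mu * q.2))}.
  by cont_tac; exact: (srf_time_cont flow pI mt0).
have cex : {for (p, t), continuous excess}.
  by rewrite /excess; cont_tac; rewrite gt_eqF.
have [dN deta _ _ _] := HN (excess (p, t)).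
have cN := is_derive_continuous _ _ _ dN.
have ceta := is_derive_continuous _ _ _ deta.
have cln : {for 1 + w (p, t), continuous (@ln R)}.
  by apply: continuous_ln; rewrite addr_gt0.
by rewrite /density_rate; cont_tac.
Qed.

Lemma density_space_cont (p t : R) : 0 < p < beta -> 0 < t ->
  {for p, continuous (fun q => density (q, t))}.
Proof.
move=> pI t0; have w0 := srf_gt0 flow pI t0.
have d1 := srf_space flow pI t0.
have d2 := excess_space p t pI t0.
have [dN _ _ _ _] := HN (excess (p, t)).
have d3 := @is_derive_compf _ N (fun q => excess (q, t)) p _ _ dN d2.
have [d dd] : exists d, is_derive p 1 (fun q => density (q, t)) d.
  eexists; rewrite /density /entropy /=; derive_tac; last reflexivity.
  by rewrite addr_gt0.
exact: is_derive_continuous dd.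
Qed.

Lemma density_ge (p t : R) : 0 < p < beta -> 0 < t ->
  (w (p, mu * t) / mu - w (p, t)) / 2 <= density (p, t).
Proof.
move=> pI t0; have w0 := srf_gt0 flow pI t0.
have [_ _ [_ _ _ _ Ns] _ _] := HN (excess (p, t)).
have := entropy_ge0 _ (ltW w0); rewrite /density => h.
have := mulr_ge0 sg_ge0 h; have := ler_wpM2l (ltW w0) Ns.
rewrite {1}/excess/= mulrBr mulr1 mulrCA divff ?gt_eqF// mulr1.
by lra.
Qed.

Lemma density_ge0 (p t : R) : 0 < p < beta -> 0 < t -> 0 <= density (p, t).
Proof.
move=> pI t0; have w0 := srf_gt0 flow pI t0.
have [_ _ [_ _ _ Ns _] _ _] := HN (excess (p, t)).
rewrite /density addr_ge0// ?divr_ge0// ?mulr_ge0 ?divr_ge0// ?(ltW w0)//.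
by rewrite entropy_ge0// ltW.
Qed.

Lemma density_le (p t M : R) : 0 < p < beta -> 0 < t -> excess (p, t) <= 0 ->
  w (p, t) <= M -> density (p, t) <= M * e / 2 + sg * (entropy M / 2).
Proof.
move=> pI t0 ex wM; have w0 := srf_gt0 flow pI t0.
have [_ _ [_ _ _ Ns _] _ /(_ ex) Ne] := HN (excess (p, t)).
rewrite /density lerD//; last first.
  by rewrite ler_wpM2l// ler_pM2r// entropy_le// ltW.
by rewrite ler_pM2r// ler_pM// ltW.
Qed.

Lemma angle_bound q : - (pi / 2) <= A q <= pi / 2.
Proof. by rewrite /A /radial_angle !ltW ?atan_gtNpi2 ?atan_ltpi2. Qed.

(** Inflow and entropy loss share the factor [A + pi / 2], which lies in [[0, pi]]; [k] bounds the
    remaining coefficient, since [eta <= 1]. *)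
Lemma flux_left (p t k : R) : 0 <= k -> 1 - sg * ln (1 + w (p, t)) <= k ->
  - flux 1 (p, t) <= pi * k.
Proof.
move=> k0 hk; rewrite /flux /=.
have [_ _ [_ e0 e1 _ _] _ _] := HN (excess (p, t)).
have /andP[a1 a2] := angle_bound (p, t).
have /andP[b1 b2] := angle_bound (p, mu * t).
by nra.
Qed.

Lemma flux_right (p t k : R) : 0 <= k -> 1 - sg * ln (1 + w (p, t)) <= k ->
  flux (- 1) (p, t) <= pi * k.
Proof.
move=> k0 hk; rewrite /flux /=.
have [_ _ [_ e0 e1 _ _] _ _] := HN (excess (p, t)).
have /andP[a1 a2] := angle_bound (p, t).
have /andP[b1 b2] := angle_bound (p, mu * t).
by nra.
Qed.

(* [k = 1] is always admissible, and [k = 0] is as soon as the radius is large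
   at both ends. *)
Lemma rate_bound (d t k C : R) (Y : R -> R) : 0 < d -> d < beta / 2 -> 0 < t ->
  0 <= C -> 0 <= e -> 0 <= k ->
  1 - sg * ln (1 + w (d, t)) <= k -> 1 - sg * ln (1 + w (beta - d, t)) <= k ->
  (forall p, d <= p <= beta - d -> `|wt (p, t)| <= C) ->
  (forall p, d <= p <= beta - d -> is_derive p 1 Y (density_rate (p, t))) ->
  Y (beta - d) - Y d <=
    beta * (C * e / 2 + 2 * sg) + sg * (pi * ln (1 + w (beta / 2, t))) +
    2 * (pi * k).
Proof.
move=> d0 db t0 C0 e0 k0 kd kb HC HY.
pose S := C * e / 2 + 2 * sg.
have S0 : 0 <= S by rewrite addr_ge0// ?divr_ge0// mulr_ge0.
(* [flux c + S * p - Y] has nonnegative derivative in [p]. It is used with [c = 1] on the left half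
   and [c = -1] on the right half, so that each end sees the shift that suits it. *)
have half (c a b : R) : (c == 1) || (c == -1) -> d <= a -> a <= b ->
    b <= beta - d -> Y b - Y a <= flux c (b, t) - flux c (a, t) + S * (b - a).
  move=> c1 da ab bd.
  have /choice[dQ HdQ] : forall p, exists dQ, a <= p <= b ->
      is_derive p 1 (fun q => flux c (q, t)) dQ /\ density_rate (p, t) <= dQ + S.
    move=> p; have [pI|pI] := pselect (a <= p <= b); last by exists 0.
    have [|||dQ ? ?] := @flux_space c C p t c1; last by exists dQ.
    - by move: pI => /andP[? ?]; apply/andP; split; lra.
    - by [].
    - by apply: HC; move: pI => /andP[? ?]; apply/andP; split; lra.
  have := @mean_value_ge _ (fun p => flux c (p, t) + S * p - Y p)
    (fun p => dQ p + S - density_rate (p, t)) a b 0 ab.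
  rewrite mul0r => H; suff : 0 <= flux c (b, t) + S * b - Y b - (flux c (a, t) + S * a - Y a) by lra.
  apply: H => p pI; have [h1 h2] := HdQ p pI; last by lra.
  have h3 : is_derive p 1 Y (density_rate (p, t)).
    by apply: HY; move: pI => /andP[? ?]; apply/andP; split; lra.
  by derive_tac; ring.
have := @half 1 d (beta / 2); have := @half (-1) (beta / 2) (beta - d).
rewrite !eqxx orbT /= => /(_ isT ltac:(lra) ltac:(lra) (lexx _)) hr.
move=> /(_ isT (lexx _) ltac:(lra) ltac:(lra)) hl.
have fl := flux_left _ _ _ k0 kd; have fr := flux_right _ _ _ k0 kb.
(* The price of changing [c] at the midpoint, and the reason why the radius has to be bounded
   there. *)
have mid : flux 1 (beta / 2, t) - flux (- 1) (beta / 2, t) =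
    sg * (pi * ln (1 + w (beta / 2, t))) by rewrite /flux; field.
have : S * (beta - d - d) <= beta * S by rewrite mulrC ler_wpM2r//; lra.
by rewrite -/S; lra.
Qed.

(** Both sides estimate the integral of [density] over [[d, beta - d]] at time [tau]. From below,
    only [[c1, d1]] is counted. From above, the integral starts small because [excess <= 0] at [t0];
    on [[t0, a]] the ends are uncontrolled and contribute up to [2 * pi] per unit time ([k = 1]),
    while on [[a, tau]] the entropy closes them ([k = 0]). *)
Lemma total_bound (d t0 a tau M C f0 c1 d1 K : R) :
  0 < d -> d < beta / 2 -> 0 < t0 -> t0 <= a -> a <= tau -> 0 <= C -> 0 <= e ->
  0 <= M -> 0 <= K ->
  (forall p t, d <= p <= beta - d -> t0 <= t <= tau -> `|wt (p, t)| <= C) ->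
  (forall t, t0 <= t <= tau -> ln (1 + w (beta / 2, t)) <= f0) ->
  (forall t, a <= t <= tau -> 1 <= sg * ln (1 + w (d, t)) /\
     1 <= sg * ln (1 + w (beta - d, t))) ->
  (forall p, d <= p <= beta - d -> excess (p, t0) <= 0 /\ w (p, t0) <= M) ->
  d <= c1 -> c1 <= d1 -> d1 <= beta - d ->
  (forall p, c1 <= p <= d1 -> K <= w (p, mu * tau) / mu - w (p, tau)) ->
  K / 2 * (d1 - c1) <= beta * (M * e / 2 + sg * (entropy M / 2)) +
    (tau - t0) * (beta * (C * e / 2 + 2 * sg) + sg * (pi * f0)) +
    2 * pi * (a - t0).
Proof.
move=> d0 db t00 t0a atau C0 e0 M0 K0 HC Hf Hends Hinit dc cd d1b HK.
(* The rectangle is enlarged so that the closed ranges of [p] and [t] lie in its interior, where the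
   primitives are differentiable. *)
have [M' M'0 HM'] : exists2 M', 0 < M' & forall p t,
    d / 2 <= p <= beta - d / 2 -> t0 / 2 <= t <= tau + 1 ->
    `|density_rate (p, t)| <= M'.
  apply: rectangle_bound => p t /andP[p1 p2] /andP[? ?].
  by apply: density_rate_cont; [apply/andP; split|]; lra.
have [|X [Y HXY]] := @parametric_primitive R (fun p t => density (p, t))
    (fun p t => density_rate (p, t)) (d / 2) (beta - d / 2) (t0 / 2) (tau + 1) M'.
  move=> p t /andP[p1 p2] /andP[t1 t2].
  have pI : 0 < p < beta by apply/andP; split; lra.
  have t'0 : 0 < t by lra.
  split; last by apply: HM'; apply/andP; split; lra.
  - exact: density_time.
  - exact: density_space_cont.
  - apply: (@continuous_compf _ _ _ density_rate (fun q => (q, t))).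
      exact: density_rate_cont.
    by cont_tac.
have d2 : d / 2 < d by rewrite gtr_pMr ?invf_lt1 ?ltr1n.
have widen p t : d <= p <= beta - d -> t0 <= t <= tau ->
    d / 2 < p < beta - d / 2 /\ t0 / 2 < t < tau + 1.
  move=> /andP[p1 p2] /andP[t1 t2]; split; apply/andP; split; lra.
have bd : d <= beta - d by lra.
have dI : d <= d <= beta - d by rewrite lexx.
have bI : d <= beta - d <= beta - d by rewrite lexx bd.
have inb p : d <= p <= beta - d -> 0 < p < beta := itv_shrink d beta p d0.
have tpos t : t0 <= t <= tau -> 0 < t by move=> /andP[t1 _]; exact: lt_le_trans t1.
(* The integral of [density] over [[d, beta - d]]. *)
pose h t := X (beta - d) t - X d t.
have dh t : t0 <= t <= tau -> is_derive t 1 h (Y (beta - d) t - Y d t).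
  move=> tI; have [b1 b2] := widen _ _ bI tI; have [a1 a2] := widen _ _ dI tI.
  have [_ _ e1] := HXY (beta - d) t b1 b2; have [_ _ e2] := HXY d t a1 a2.
  by rewrite /h; derive_tac.
have dY p t : d <= p <= beta - d -> t0 <= t <= tau ->
    is_derive p 1 (Y^~ t) (density_rate (p, t)).
  by move=> pI tI; have [p1 p2] := widen _ _ pI tI; have [_ hY _] := HXY p t p1 p2; exact: hY.
have dX p t : d <= p <= beta - d -> t0 <= t <= tau ->
    is_derive p 1 (X^~ t) (density (p, t)).
  by move=> pI tI; have [p1 p2] := widen _ _ pI tI; have [hX _ _] := HXY p t p1 p2; exact: hX.
pose K1 := beta * (C * e / 2 + 2 * sg) + sg * (pi * f0).
have rate t k : t0 <= t <= tau -> 0 <= k ->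
    1 - sg * ln (1 + w (d, t)) <= k -> 1 - sg * ln (1 + w (beta - d, t)) <= k ->
    Y (beta - d) t - Y d t <= K1 + 2 * (pi * k).
  move=> tI k0 hk1 hk2; have t'0 := tpos t tI.
  have := rate_bound d t k C (Y^~ t) d0 db t'0 C0 e0 k0 hk1 hk2
    (fun p pI => HC p t pI tI) (fun p pI => dY p t pI tI).
  have : sg * (pi * ln (1 + w (beta / 2, t))) <= sg * (pi * f0).
    by rewrite ler_wpM2l// ler_wpM2l ?pi_ge0// Hf.
  by rewrite /K1; lra.
have gap p t : d <= p <= beta - d -> t0 <= t <= tau -> 1 - sg * ln (1 + w (p, t)) <= 1.
  move=> pI tI; have w0 := srf_gt0 flow (inb p pI) (tpos t tI).
  by rewrite gerBl mulr_ge0// ln_ge0// lerDl ltW.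
have step1 : h a - h t0 <= (K1 + 2 * pi) * (a - t0).
  apply: (mean_value_le h (fun t => Y (beta - d) t - Y d t)) => // t /andP[t1 t2];
    have tI : t0 <= t <= tau by rewrite t1 (le_trans t2).
    exact: dh.
  by rewrite -[in leRHS](mulr1 pi); apply: rate => //; exact: gap.
have step2 : h tau - h a <= K1 * (tau - a).
  apply: (mean_value_le h (fun t => Y (beta - d) t - Y d t)) => // t /andP[t1 t2];
    have tI : t0 <= t <= tau by rewrite t2 (le_trans t0a).
    exact: dh.
  have [|h1 h2] := Hends t; first by rewrite t1.
  by have := rate t 0; rewrite !mulr0 addr0 !subr_le0; apply.
have step0 : h t0 <= beta * (M * e / 2 + sg * (entropy M / 2)).
  have B0 : 0 <= M * e / 2 + sg * (entropy M / 2).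
    by rewrite addr_ge0// ?mulr_ge0// ?divr_ge0// ?mulr_ge0// entropy_ge0.
  apply: (@le_trans _ _ ((M * e / 2 + sg * (entropy M / 2)) * (beta - d - d))).
    apply: (mean_value_le (X^~ t0) (fun p => density (p, t0))) => // p pI.
      by apply: dX; rewrite ?lexx ?(le_trans t0a).
    have [ex wM] := Hinit p pI.
    by apply: density_le => //; exact: inb.
  by rewrite mulrC ler_wpM2r// -addrA gerDl -opprD oppr_le0 addr_ge0 ?ltW.
have tauI : t0 <= tau <= tau by rewrite lexx (le_trans t0a).
have tau0 : 0 < tau by exact: tpos.
have sub x y p : d <= x -> y <= beta - d -> x <= p <= y -> d <= p <= beta - d.
  by move=> dx yb /andP[xp py]; rewrite (le_trans dx)// (le_trans py).
have stepm x y k : d <= x -> x <= y -> y <= beta - d ->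
    (forall p, x <= p <= y -> k <= density (p, tau)) ->
    k * (y - x) <= X y tau - X x tau.
  move=> dx xy yb Hk; apply: (mean_value_ge (X^~ tau) (fun p => density (p, tau))) => //.
  by move=> p pI; apply: dX => //; exact: sub pI.
have dens0 x y p : d <= x -> y <= beta - d -> x <= p <= y -> 0 <= density (p, tau).
  by move=> dx yb pI; apply: density_ge0 => //; apply/inb/(sub x y).
have c1b := le_trans cd d1b; have dd1 := le_trans dc cd.
(* The density is nonnegative, so the parts outside [[c1, d1]] may be dropped. *)
have s1 := stepm d c1 0 (lexx _) dc c1b (fun p => dens0 d c1 p (lexx _) c1b).
have s3 := stepm d1 (beta - d) 0 dd1 d1b (lexx _) (fun p => dens0 d1 (beta - d) p dd1 (lexx _)).
have s2 : K / 2 * (d1 - c1) <= X d1 tau - X c1 tau.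
  apply: stepm => // p pI; apply: le_trans (density_ge p tau _ tau0).
    by rewrite ler_pM2r// HK.
  exact/inb/(sub c1 d1).
rewrite -/K1; move: step0 step1 step2 s1 s2 s3; rewrite /h !mul0r.
by lra.
Qed.

End contraction.

Lemma exists_small_factor {R : realType} (a k : R) : 0 <= a -> 0 < k ->
  exists2 s, 0 < s & s * a < k.
Proof.
move=> a0 k0; have a1 : 0 < a + 1 by lra.
exists (k / (a + 1)); first exact: divr_gt0.
by rewrite mulrAC ltr_pdivrMr// ltr_pM2l//; lra.
Qed.

(** * From the integral estimate to the pointwise rate inequality *)

Section monotonicity.
Context {R : realType} (beta : R) (w wt wp : R * R -> R).
Hypothesis flow : squared_radius_flow beta w wt wp.
Hypothesis initial_cont : forall p eps : R, 0 < p < beta -> 0 < eps ->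
  exists2 del, 0 < del & forall q t, `|q - p| < del -> 0 <= t < del ->
    `|w (q, t) - w (p, 0)| < eps.
Variable M0 : R.
Hypothesis initial_bound : forall p : R, 0 < p < beta -> 0 < w (p, 0) <= M0.
Hypothesis ends : forall L a tau : R, 0 < a ->
  exists2 d0, 0 < d0 & forall d t, 0 < d < d0 -> a <= t <= tau ->
    L <= w (d, t) /\ L <= w (beta - d, t).

(** At time 0 the rescaled flow is [w / mu], which lies strictly below [w]. Continuity keeps this
    true near each angle for a short time, and compactness of [[d, beta - d]] gives one time for all
    angles. *)
Lemma initial_slice (d a mu : R) : 0 < d -> 0 < a -> 1 < mu ->
  exists2 t, 0 < t < a & forall p, d <= p <= beta - d ->
    w (p, t) < M0 + 1 /\ w (p, mu * t) / mu < w (p, t).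
Proof.
move=> d0 a0 mu1; have mu0 : 0 < mu by lra.
have /compact_near_coveringP cov := @segment_compact R d (beta - d).
have : \forall t \near (0 : R)^'+, `[d, beta - d] `<=` (fun p : R =>
    w (p, t) < M0 + 1 /\ w (p, mu * t) / mu < w (p, t)).
  apply: (cov R _ (fun t p : R =>
    w (p, t) < M0 + 1 /\ w (p, mu * t) / mu < w (p, t))) => p; rewrite /= in_itv/= => /andP[p1 p2].
  have pI : 0 < p < beta by apply/andP; split; lra.
  have /andP[w0 wM] := initial_bound _ pI.
  (* The second entry is the largest [eps] with [(w (p, 0) + eps) / mu <= w (p, 0) - eps]; the entry
     1 yields the bound [M0 + 1]. *)
  pose eps := Num.min 1 (w (p, 0) * (mu - 1) / (mu + 1)).
  have eps0 : 0 < eps by rewrite lt_min ltr01 divr_gt0// ?mulr_gt0//; lra.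
  have [del del0 Hdel] := initial_cont _ _ pI eps0.
  have e1 : eps <= 1 by rewrite ge_min lexx.
  have e2 : eps * (mu + 1) <= w (p, 0) * (mu - 1).
    by rewrite -ler_pdivlMr ?ge_min ?lexx ?orbT//; lra.
  near=> q t => /=.
  have qp : `|q - p| < del.
    by near: q; apply: cvgr_distC_lt.
  have t0 : 0 < t by near: t; exact: nbhs_right_gt.
  have tdel : t < del / mu by near: t; apply: nbhs_right_lt; exact: divr_gt0.
  have mtdel : mu * t < del by rewrite mulrC -ltr_pdivlMr.
  have tmt : t < mu * t by rewrite ltr_pMl.
  have := Hdel q t qp; have := Hdel q (mu * t) qp.
  rewrite !ltr_norml => /(_ ltac:(apply/andP; split; lra)) /andP[h1 h2].
  move=> /(_ ltac:(apply/andP; split; lra)) /andP[h3 h4].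
  split; first by lra.
  by rewrite ltr_pdivrMr//; nra.
move=> H; near (0 : R)^'+ => t; exists t.
  apply/andP; split; near: t; [exact: nbhs_right_gt|exact: nbhs_right_lt].
move=> p pI; have : `[d, beta - d]%classic p by rewrite /= in_itv.
by move: p {pI}; near: t.
Unshelve. all: end_near. Qed.

(** Continuity of the flow for positive times does not reach time 0: continuity at the initial time
    handles [t < del / 2], compactness the rest. *)
Lemma midpoint_bound (tau : R) : 0 < beta -> 0 < tau -> exists2 f0, 0 <= f0 &
  forall t, 0 < t <= tau -> ln (1 + w (beta / 2, t)) <= f0.
Proof.
move=> beta0 tau0; have mI : 0 < beta / 2 < beta by apply/andP; split; lra.
have [del del0 Hdel] := initial_cont _ _ mI ltr01.
have [|M M0' HM] := @rectangle_bound R w (beta / 2) (beta / 2) (del / 2) tau.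
  move=> p t /andP[p1 p2] /andP[t1 t2]; apply: (srf_cont flow); last by lra.
  by apply/andP; split; lra.
have := HM; have /andP[w00 w0M] := initial_bound _ mI.
move=> {}HM; exists (ln (1 + (M + w (beta / 2, 0) + 1))).
  by rewrite ln_ge0//; lra.
move=> t /andP[t0 tt]; have w0 := srf_gt0 flow mI t0.
rewrite ler_ln ?posrE; [|lra|lra].
have [td|td] := leP (del / 2) t.
  by have := HM _ t ltac:(apply/andP; split; exact: lexx)
    ltac:(apply/andP; split; lra); rewrite ler_norml => /andP[_]; lra.
have := Hdel (beta / 2) t; rewrite subrr normr0 => /(_ del0).
move=> /(_ ltac:(apply/andP; split; lra)); rewrite ltr_norml => /andP[_].
by lra.
Qed.

(** A violation at [p] persists on an interval [[c1, d1]] at time [tau], so the integral of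
    [density] there has a fixed positive lower bound, whereas the upper bound can be made
    arbitrarily small. *)
Lemma squared_radius_comparison (mu p tau : R) : 1 < mu -> 0 < p < beta ->
  0 < tau -> w (p, mu * tau) / mu <= w (p, tau).
Proof.
move=> mu1 pI tau0; have mu0 : 0 < mu by lra.
have /andP[p1 p2] := pI; have beta0 : 0 < beta by lra.
have mtau0 : 0 < mu * tau by rewrite mulr_gt0.
rewrite leNgt; apply/negP => lt_w.
pose g q := w (q, mu * tau) / mu - w (q, tau).
have cg : {for p, continuous g}.
  have c1 := is_derive_continuous _ _ _ (srf_space flow pI tau0).
  have c2 := is_derive_continuous _ _ _ (srf_space flow pI mtau0).
  by rewrite /g; cont_tac; rewrite gt_eqF.
pose K := g p / 2.
have K0 : 0 < K by rewrite /K divr_gt0// subr_gt0.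
have [eps /= eps0 Heps] : nbhs p (fun q => K < g q).
  by apply: (cvgr_gt _ cg); move: K0; rewrite /K; lra.
pose c1 := Num.max (p - eps / 2) (p / 2).
pose d1 := Num.min (p + eps / 2) ((p + beta) / 2).
have c1p : c1 < p by rewrite gt_max; apply/andP; split; lra.
have pd1 : p < d1 by rewrite lt_min; apply/andP; split; lra.
have c10 : 0 < c1 by rewrite lt_max; apply/orP; right; lra.
have d1b : d1 < beta by rewrite gt_min; apply/orP; right; lra.
have HK q : c1 <= q <= d1 -> K <= g q.
  rewrite ge_max le_min => /andP[/andP[q1 _] /andP[q2 _]].
  by apply/ltW/Heps; rewrite /= ltr_norml; apply/andP; split; lra.
(* The lower bound. The three error terms, governed by [sg], [a] and [e], are each kept below a
   quarter of it. *)
pose k1 := K / 2 * (d1 - c1).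
have k10 : 0 < k1 by rewrite /k1 !mulr_gt0// subr_gt0; lra.
have [f0 f00 Hf0] := midpoint_bound _ beta0 tau0.
have M00 : 0 <= M0 + 1 by have /andP[? ?] := initial_bound _ pI; lra.
have ent0 : 0 <= entropy (M0 + 1) / 2 by rewrite divr_ge0// entropy_ge0.
have mid0 : 0 <= 2 * beta + pi * f0.
  by apply: addr_ge0; [lra|rewrite mulr_ge0// pi_ge0].
have [sg sg0 Hsg] := @exists_small_factor R
  (beta * (entropy (M0 + 1) / 2) + tau * (2 * beta + pi * f0)) (k1 / 4)
  (addr_ge0 (mulr_ge0 (ltW beta0) ent0) (mulr_ge0 (ltW tau0) mid0))
  ltac:(by rewrite divr_gt0).
have [a' a'0 Ha'] := @exists_small_factor R (2 * pi) (k1 / 4)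
  ltac:(by rewrite mulr_ge0// pi_ge0) ltac:(by rewrite divr_gt0).
pose a := Num.min a' tau.
have a0 : 0 < a by rewrite lt_min a'0.
have atau : a <= tau by rewrite ge_min lexx orbT.
have aa' : a <= a' by rewrite ge_min lexx.
(* Once [w] exceeds [expR sg^-1], the product [sg * ln (1 + w)] exceeds 1: from time [a] on, both
   ends are closed. *)
have [d0 d00 Hd0] := ends (expR sg^-1) a tau a0.
pose d := Num.min (Num.min (d0 / 2) (beta / 3)) (Num.min c1 (beta - d1)).
have dpos : 0 < d by rewrite !lt_min c10; apply/andP; split; [apply/andP; split; lra|lra].
have dd0 : d < d0.
  by rewrite (@le_lt_trans _ _ (d0 / 2)) ?gtr_pMr ?invf_lt1 ?ltr1n// /d !ge_min lexx.
have db : d <= beta / 3 by rewrite /d !ge_min lexx !orbT.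
have dc1 : d <= c1 by rewrite /d !ge_min lexx !orbT.
have dd1 : d <= beta - d1 by rewrite /d !ge_min lexx !orbT.
have [t0 /andP[t00 t0a] Ht0] := initial_slice d a mu dpos a0 mu1.
have cwt q t : d <= q <= beta - d -> t0 <= t <= tau -> {for (q, t), continuous wt}.
  move=> qI /andP[t1 _]; apply: (srf_time_cont flow); first exact: itv_shrink qI.
  exact: lt_le_trans t1.
have [C C0 HC] := rectangle_bound wt _ _ _ _ cwt.
(* [C] bounds [wt] on a range that depends on [d] and [t0], with no uniform control; [e] is chosen
   last in order to absorb it. *)
have [e e0 He] := @exists_small_factor R
  (beta * ((M0 + 1) / 2) + tau * (beta * (C / 2))) (k1 / 4)
  (addr_ge0 (mulr_ge0 (ltW beta0) (divr_ge0 M00 (ler0n _ 2)))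
    (mulr_ge0 (ltW tau0) (mulr_ge0 (ltW beta0) (divr_ge0 (ltW C0) (ler0n _ 2)))))
  ltac:(by rewrite divr_gt0).
have [N [eta [eta' HN]]] := smooth_positive_part e e0.
have posw q t : d <= q <= beta - d -> 0 < t -> 0 < w (q, t).
  by move=> qI t'0; apply: (srf_gt0 flow) => //; exact: itv_shrink qI.
have Hends t : a <= t <= tau -> 1 <= sg * ln (1 + w (d, t)) /\
    1 <= sg * ln (1 + w (beta - d, t)).
  move=> tI; have [|h1 h2] := Hd0 d t _ tI; first by rewrite dpos.
  have aux x : expR sg^-1 <= x -> 1 <= sg * ln (1 + x).
    move=> hx; rewrite mulrC -ler_pdivrMr// mul1r -[leLHS]expRK ler_ln ?posrE ?expR_gt0//.
      by rewrite (le_trans hx)// lerDr.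
    by rewrite ltr_wpDr// (le_trans _ hx)// expR_ge0.
  by split; apply: aux.
have Hinit q : d <= q <= beta - d ->
    excess w mu (q, t0) <= 0 /\ w (q, t0) <= M0 + 1.
  move=> qI; have [h1 h2] := Ht0 q qI; split; last exact: ltW.
  by rewrite /excess subr_le0 ler_pdivrMr ?mul1r ?ltW// posw.
have Hf t : t0 <= t <= tau -> ln (1 + w (beta / 2, t)) <= f0.
  by move=> /andP[t1 t2]; apply: Hf0; rewrite t2 (lt_le_trans t00).
have db' : d < beta / 2 by apply: le_lt_trans db _; rewrite ltr_pM2l// ltf_pV2 ?posrE// ltr_nat.
have cd : c1 <= d1 by exact/ltW/(lt_trans c1p).
have d1d : d1 <= beta - d by rewrite lerBrDl -lerBrDr.
have := @total_bound R beta w wt wp flow mu sg e N eta eta' mu0 (ltW sg0) HN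
  d t0 a tau (M0 + 1) C f0 c1 d1 K dpos db' t00 (ltW t0a) atau (ltW C0)
  (ltW e0) M00 (ltW K0) HC Hf Hends Hinit dc1 cd d1d HK.
apply/negP; rewrite -ltNge -/k1.
have h1 : (tau - t0) * (beta * (C * e / 2 + 2 * sg) + sg * (pi * f0)) <=
    tau * (beta * (C * e / 2 + 2 * sg) + sg * (pi * f0)).
  apply: ler_wpM2r; last by lra.
  apply: addr_ge0; last first.
    by apply: mulr_ge0; [exact: ltW|rewrite mulr_ge0// pi_ge0].
  apply: mulr_ge0; first exact: ltW.
  apply: addr_ge0; last by rewrite mulr_ge0// ltW.
  by rewrite divr_ge0// mulr_ge0// ltW.
have h2 : 2 * pi * (a - t0) < k1 / 4.
  apply: le_lt_trans Ha'; rewrite mulrC; apply: ler_wpM2r; last by lra.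
  by rewrite mulr_ge0// pi_ge0.
have -> : beta * ((M0 + 1) * e / 2 + sg * (entropy (M0 + 1) / 2)) =
    e * (beta * ((M0 + 1) / 2)) + sg * (beta * (entropy (M0 + 1) / 2)) by ring.
apply: le_lt_trans (_ : e * (beta * ((M0 + 1) / 2) + tau * (beta * (C / 2))) +
  sg * (beta * (entropy (M0 + 1) / 2) + tau * (2 * beta + pi * f0)) +
  2 * pi * (a - t0) < k1); last by move: He Hsg h2; lra.
by move: h1; rewrite !mulrDr; lra.
Qed.

(** By comparison with [mu] slightly above 1, after time [tau] the function [w (p, _)] stays below
    the line through the origin and its value at [tau]. A derivative steeper than that line would
    persist by continuity of [wt] and push it above. *)
Lemma squared_radius_rate (p tau : R) : 0 < p < beta -> 0 < tau ->
  tau * wt (p, tau) <= w (p, tau).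
Proof.
move=> pI tau0; rewrite leNgt; apply/negP => lt_w.
have cwt : {for tau, continuous (fun s => wt (p, s) - w (p, tau) / tau)}.
  by cont_tac; exact: (srf_time_cont flow).
have [eps /= eps0 Heps] : nbhs tau (fun s => 0 < wt (p, s) - w (p, tau) / tau).
  by apply: (cvgr_gt _ cwt); rewrite subr_gt0 ltr_pdivrMr// mulrC.
pose g s := w (p, s) - s * (w (p, tau) / tau).
have [||c /andP[c1 c2]] := @mean_value _ g
    (fun s => wt (p, s) - w (p, tau) / tau) tau (tau + eps / 2).
- by lra.
- move=> s /andP[s1 s2]; have s0 : 0 < s by lra.
  by have d1 := srf_time flow pI s0; rewrite /g; derive_tac; ring.
have -> : tau + eps / 2 - tau = eps / 2 by ring.
have : 0 < wt (p, c) - w (p, tau) / tau.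
  by apply: Heps; rewrite /= ltr_norml; apply/andP; split; lra.
move=> dc0 E; have : 0 < g (tau + eps / 2) - g tau.
  by rewrite E mulr_gt0// divr_gt0.
have te : 0 < tau + eps / 2 by lra.
have := @squared_radius_comparison ((tau + eps / 2) / tau) p tau.
rewrite ltr_pdivlMr// mul1r => /(_ ltac:(lra) pI tau0).
rewrite divfK ?gt_eqF// ler_pdivrMr ?divr_gt0// /g.
have -> : tau * (w (p, tau) / tau) = w (p, tau) by field; rewrite gt_eqF.
have -> : w (p, tau) * ((tau + eps / 2) / tau) = (tau + eps / 2) * (w (p, tau) / tau).
  by field; rewrite gt_eqF.
by lra.
Qed.

End monotonicity.

(** * Smooth functions and plane curves *)

Lemma open_setX {U V : topologicalType} (A : set U) (B : set V) :
  open A -> open B -> open (A `*` B).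
Proof.
move=> oA oB; rewrite openE => -[x y] [/= Ax By].
by exists (A, B) => //; split; exact: open_nbhs_nbhs.
Qed.

Section smooth.
Context {R : realType} {V : normedModType R}.

(** On an open set [f] coincides with its local extension near each point, so continuity and
    directional derivatives carry over. The derivatives of [g] are local extensions of those of [f],
    which feeds the induction on the order. *)
Lemma Ck_local (n : nat) (A : set (R * R)) (f : R * R -> V) : open A ->
  (forall x, A x -> exists (U : set (R * R)) (g : R * R -> V),
    [/\ open U, U x, Ck n U g & forall y, U y -> A y -> f y = g y]) ->
  Ck n A f.
Proof.
elim: n A f => [|n IH] A f oA H.
all: have loc x U g : open U -> U x -> A x -> (forall y, U y -> A y -> f y = g y) ->
    \forall y \near x, g y = f y by
  move=> oU Ux Ax fg; apply: filterS2 (open_nbhs_nbhs (conj oU Ux))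
    (open_nbhs_nbhs (conj oA Ax)) => y Uy Ay; rewrite fg.
all: have cf x : A x -> {for x, continuous f} by
  move=> Ax; have [U [g [oU Ux [cg _] fg]]] := H x Ax;
  have e := loc x U g oU Ux Ax fg;
  have gx : g x = f x := nbhs_singleton e;
  move: (cg x Ux); rewrite /prop_for /continuous_at gx; apply: cvg_trans;
  exact: near_eq_cvg.
  by split.
split=> //.
have D v x U g : open U -> U x -> A x -> (forall y, U y -> A y -> f y = g y) ->
    'D_v f x = 'D_v g x.
  move=> oU Ux Ax fg; apply/esym/near_eq_derive; exact: loc fg.
split.
- move=> x Ax; have [U [g [oU Ux [_ [dg _ _]] fg]]] := H x Ax.
  have [d1 d2] := dg x Ux; have e := loc x U g oU Ux Ax fg.
  by split; [exact: near_eq_derivable d1|exact: near_eq_derivable d2].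
- apply: IH => // x Ax; have [U [g [oU Ux [_ [_ Cg _]] fg]]] := H x Ax.
  by exists U, ('D_(1, 0) g); split => // y Uy Ay; exact: D fg.
- apply: IH => // x Ax; have [U [g [oU Ux [_ [_ _ Cg]] fg]]] := H x Ax.
  by exists U, ('D_(0, 1) g); split => // y Uy Ay; exact: D fg.
Qed.

Lemma smooth_on_Ck (A B : set (R * R)) (f : R * R -> V) (n : nat) :
  open B -> B `<=` A -> smooth_on A f -> Ck n B f.
Proof.
move=> oB BA sf; apply: Ck_local => // x Bx.
have [U [g [oU Ux Cg fg]]] := sf x (BA x Bx).
by exists U, g; split => // y Uy By; apply: fg => //; exact: BA.
Qed.

Lemma derive_slice_fst (f : R * R -> V) (p t : R) : derivable f (p, t) (1, 0) ->
  is_derive p 1 (fun q => f (q, t)) ('D_(1, 0) f (p, t)).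
Proof.
move=> df; have E : (fun h : R => h^-1 *: ((fun q => f (q, t)) (h *: 1 + p) - f (p, t))) =
    (fun h : R => h^-1 *: (f (h *: (1, 0) + (p, t)) - f (p, t))).
  apply/funext => h; congr (_ *: (f _ - _)).
  by congr (_, _) => /=; rewrite /GRing.scale /= ?mulr0 ?add0r.
by apply: DeriveDef; rewrite /derivable /derive /= E.
Qed.

Lemma derive_slice_snd (f : R * R -> V) (p t : R) : derivable f (p, t) (0, 1) ->
  is_derive t 1 (fun s => f (p, s)) ('D_(0, 1) f (p, t)).
Proof.
move=> df; have E : (fun h : R => h^-1 *: ((fun s => f (p, s)) (h *: 1 + t) - f (p, t))) =
    (fun h : R => h^-1 *: (f (h *: (0, 1) + (p, t)) - f (p, t))).
  apply/funext => h; congr (_ *: (f _ - _)).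
  by congr (_, _) => /=; rewrite /GRing.scale /= ?mulr0 ?add0r.
by apply: DeriveDef; rewrite /derivable /derive /= E.
Qed.

End smooth.

Section plane_valued.
Context {R : realType}.
Implicit Types (c : R -> R * R) (u : R).

Lemma is_derive_cvgP {V : normedModType R} (f : R -> V) u (d : V) :
  is_derive u 1 f d <->
  (fun h : R => h^-1 *: (f (h *: 1 + u) - f u)) @ 0^' --> d.
Proof.
split=> [[df <-] //|H]; apply: DeriveDef; last exact: cvg_lim H.
by apply/cvg_ex; exists d.
Qed.

Lemma is_derive_fst c u d : is_derive u 1 c d ->
  is_derive u 1 (fun v => (c v).1) d.1.
Proof.
move=> /is_derive_cvgP H; apply/is_derive_cvgP.
exact: (cvg_comp _ _ H (continuous_fstf d)).
Qed.

Lemma is_derive_snd c u d : is_derive u 1 c d ->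
  is_derive u 1 (fun v => (c v).2) d.2.
Proof.
move=> /is_derive_cvgP H; apply/is_derive_cvgP.
exact: (cvg_comp _ _ H (continuous_sndf d)).
Qed.

Lemma is_derive_pair (f g : R -> R) u (a b : R) :
  is_derive u 1 f a -> is_derive u 1 g b ->
  is_derive u 1 (fun v => (f v, g v)) (a, b).
Proof.
move=> /is_derive_cvgP H1 /is_derive_cvgP H2; apply/is_derive_cvgP.
exact: cvg_pair H1 H2.
Qed.

Lemma is_derive_derive1 {V : normedModType R} (f : R -> V) u (d : V) :
  is_derive u 1 f d -> derive1 f u = d.
Proof. by move=> [_ <-]; rewrite derive1E. Qed.

Lemma near_is_derive (f g : R -> R) u (d : R) : (\forall v \near u, f v = g v) ->
  is_derive u 1 f d -> is_derive u 1 g d.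
Proof. exact: near_eq_is_derive. Qed.

End plane_valued.

(** * Tangent angles and curvature *)

Section tangent_angles.
Context {R : realType}.
Implicit Types (c : R -> R * R) (u : R) (psi : R -> R).

Lemma cos_eq1_small (x : R) : `|x| < 1 -> cos x = 1 -> x = 0.
Proof.
move=> x1 cx; apply/eqP; rewrite -normr_eq0; apply/eqP.
apply: (@cos_inj R); rewrite ?in_itv/= ?lexx ?pi_ge0 ?normr_ge0 //=.
  by have := pi_ge2 R; lra.
by rewrite cos0 -cx; case: (ger0P x) => _; rewrite ?cosN.
Qed.

(** The angle selected by [get] is unknown, but its difference to [psi] has cosine 1 and sine 0 near
    [u] and, by continuity, varies by less than 1; so it is locally constant and the derivatives
    agree. *)
Lemma geodesic_curvatureE c u psi (d : R) : tangent_angle c u psi ->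
  is_derive u 1 psi d -> geodesic_curvature c u = d / speed c u.
Proof.
move=> angle dpsi; rewrite /geodesic_curvature; congr (_ / _).
set psi' := get _; have angle' : tangent_angle c u psi'.
  by rewrite /psi'; apply: getPex; exists psi.
pose g v := psi' v - psi v.
have [cpsi Tpsi] := nbhs_singleton angle.
have [cpsi' Tpsi'] := nbhs_singleton angle'.
have cg : {for u, continuous g} by rewrite /g; cont_tac.
have cos_g v : unit_tangent c v = (cos (psi v), sin (psi v)) ->
    unit_tangent c v = (cos (psi' v), sin (psi' v)) -> cos (g v) = 1 /\ sin (g v) = 0.
  move=> -> [e1 e2]; rewrite /g cosB sinB -e1 -e2.
  by split; [rewrite -!expr2 cos2Dsin2|ring].
have [cg1 sg0] := cos_g u Tpsi Tpsi'.
have const : \forall v \near u, psi v + g u = psi' v.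
  near=> v.
  have : `|g v - g u| < 1.
    by near: v; have /cvgrPdist_lt /(_ 1 ltr01) := cg; apply: filterS => v; rewrite distrC.
  have [_ Tv] : {for v, continuous psi} /\ unit_tangent c v = (cos (psi v), sin (psi v)).
    by near: v; exact: angle.
  have [_ Tv'] : {for v, continuous psi'} /\ unit_tangent c v = (cos (psi' v), sin (psi' v)).
    by near: v; exact: angle'.
  have [cgv sgv] := cos_g v Tv Tv'.
  move=> /cos_eq1_small; rewrite cosB cg1 cgv sg0 mulr1 mulr0 addr0 => /(_ erefl).
  by rewrite /g => E; lra.
apply: is_derive_derive1; apply: near_is_derive const _.
by derive_tac; rewrite addr0.
Unshelve. all: end_near. Qed.

Lemma exists_angle (x y : R) : x ^+ 2 + y ^+ 2 = 1 ->
  exists a : R, x = cos a /\ y = sin a.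
Proof.
move=> xy; have x1 : -1 <= x <= 1.
  by have := sqr_ge0 y; rewrite -ler_norml -sqrtr_sqr -sqrtr1 ler_sqrt //; lra.
have s : sin (acos x) = `|y|.
  by rewrite sin_acos// -sqrtr_sqr; congr Num.sqrt; lra.
have [y0|y0] := leP 0 y.
  by exists (acos x); rewrite acosK ?in_itv// s ger0_norm.
by exists (- acos x); rewrite cosN sinN acosK ?in_itv// s ltr0_norm// opprK.
Qed.

End tangent_angles.

Section regular_curves.
Context {R : realType}.
Implicit Types (c : R -> R * R) (u : R) (psi : R -> R) (p q : R * R).

Definition cross p q : R := p.1 * q.2 - p.2 * q.1.

Lemma dot_ge0 p : 0 <= dot p p.
Proof. by rewrite /dot -!expr2 addr_ge0// sqr_ge0. Qed.

Lemma dot_gt0 p : p != 0 -> 0 < dot p p.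
Proof.
move=> p0; rewrite lt_def dot_ge0 andbT; apply: contraNN p0.
rewrite /dot -!expr2 paddr_eq0 ?sqr_ge0// !sqrf_eq0 => /andP[/eqP a /eqP b].
by case: p a b => p1 p2 /= -> ->.
Qed.

Lemma enorm_gt0 p : p != 0 -> 0 < enorm p.
Proof. by move=> p0; rewrite sqrtr_gt0 dot_gt0. Qed.

Lemma sqr_enorm p : enorm p ^+ 2 = dot p p.
Proof. by rewrite sqr_sqrtr// dot_ge0. Qed.

Lemma speedE c u d : is_derive u 1 c d -> speed c u = enorm d.
Proof. by move=> dc; rewrite /speed (is_derive_derive1 _ _ _ dc). Qed.

Lemma unit_tangentE c u d : is_derive u 1 c d ->
  unit_tangent c u = (d.1 / enorm d, d.2 / enorm d).
Proof.
move=> dc; rewrite /unit_tangent (speedE _ _ _ dc) (is_derive_derive1 _ _ _ dc).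
by congr (_, _); rewrite /GRing.scale /= mulrC.
Qed.

Lemma unit_normalE c u d : is_derive u 1 c d ->
  unit_normal c u = (d.2 / enorm d, - (d.1 / enorm d)).
Proof.
move=> dc; rewrite /unit_normal (unit_tangentE _ _ _ dc) /rot /=.
by congr (_, _) => /=; rewrite opprK.
Qed.

Lemma support_functionE c u d : is_derive u 1 c d ->
  support_function c u = cross d (c u) / enorm d.
Proof.
move=> dc; rewrite /support_function (unit_normalE _ _ _ dc) /dot /cross /=.
ring.
Qed.

(* The angle from [c1 u] to [c1 v] is the arctangent of cross over dot. *)
Lemma regular_curve_angle c (c1 : R -> R * R) u (c2 : R * R) :
  (\forall v \near u, {for v, continuous c1} /\ is_derive v 1 c (c1 v)) ->
  c1 u != 0 -> is_derive u 1 c1 c2 ->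
  exists2 psi, tangent_angle c u psi &
    is_derive u 1 psi (cross (c1 u) c2 / dot (c1 u) (c1 u)).
Proof.
move=> near_c c1u dc1; set a := c1 u.
have a0 : 0 < dot a a by exact: dot_gt0.
have na0 : 0 < enorm a by exact: enorm_gt0.
have [|psi0 [cp sp]] := @exists_angle R (a.1 / enorm a) (a.2 / enorm a).
  rewrite !expr_div_n sqr_enorm -mulrDl /dot -!expr2 divff//.
  by move: a0; rewrite /dot -!expr2 => /gt_eqF ->.
have cfst v : {for v, continuous c1} -> {for v, continuous (fun v => (c1 v).1)}.
  by move=> h; apply: continuous_compf h; exact: continuous_fstf.
have csnd v : {for v, continuous c1} -> {for v, continuous (fun v => (c1 v).2)}.
  by move=> h; apply: continuous_compf h; exact: continuous_sndf.
have [cu _] := nbhs_singleton near_c.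
have cdot v : {for v, continuous c1} -> {for v, continuous (fun v => dot a (c1 v))}.
  by move=> h; have h1 := cfst v h; have h2 := csnd v h; rewrite /dot; cont_tac.
have near_dot : \forall v \near u, 0 < dot a (c1 v).
  exact: (cvgr_gt _ (cdot u cu)).
exists (fun v => psi0 + atan (cross a (c1 v) / dot a (c1 v))).
  rewrite /tangent_angle; near=> v.
  have [cv dc] : {for v, continuous c1} /\ is_derive v 1 c (c1 v).
    by near: v; exact: near_c.
  have d0 : 0 < dot a (c1 v) by near: v; exact: near_dot.
  have h1 := cfst v cv; have h2 := csnd v cv; have h3 := cdot v cv.
  split.
    rewrite /cross; cont_tac; first exact: continuous_atan.
    by rewrite gt_eqF.
  rewrite (unit_tangentE _ _ _ dc).
  set b := c1 v; set X := cross a b / dot a b.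
  have b0 : b != 0.
    by apply: contraTneq d0 => b0; rewrite -/b b0 /dot !mulr0 addr0 ltxx.
  have nb0 := enorm_gt0 _ b0.
  (* Lagrange's identity: the squares of [dot a b] and [cross a b] add up to [dot a a * dot b b]. *)
  have sX : Num.sqrt (1 + X ^+ 2) = enorm a * enorm b / dot a b.
    have -> : 1 + X ^+ 2 = (enorm a * enorm b / dot a b) ^+ 2.
      have -> : (enorm a * enorm b / dot a b) ^+ 2 = dot a a * dot b b / dot a b ^+ 2.
        by rewrite -!sqr_enorm; field; rewrite gt_eqF.
      by rewrite /X /cross /dot; field; rewrite -/(dot a b) gt_eqF.
    by rewrite sqrtr_sqr ger0_norm// divr_ge0 ?mulr_ge0 ?ltW.
  have cX : cos (atan X) = dot a b / (enorm a * enorm b).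
    by rewrite cos_atan sX invf_div.
  have sinX : sin (atan X) = cross a b / (enorm a * enorm b).
    have : tan (atan X) = X by exact: atanK.
    rewrite /tan cX /X => E.
    apply: (mulIf (x := (dot a b / (enorm a * enorm b))^-1)).
      by rewrite invr_eq0 mulf_neq0 ?invr_eq0 ?mulf_neq0 ?gt_eqF.
    by rewrite E; field; rewrite !gt_eqF.
  have aa : a.1 * a.1 + a.2 * a.2 = enorm a ^+ 2 by rewrite sqr_enorm.
  rewrite cosD sinD -cp -sp cX sinX; congr (_, _).
    transitivity ((a.1 * a.1 + a.2 * a.2) * b.1 / (enorm a ^+ 2 * enorm b)).
      by rewrite aa; field; rewrite !gt_eqF.
    by rewrite /dot /cross; field; rewrite !gt_eqF.
  transitivity ((a.1 * a.1 + a.2 * a.2) * b.2 / (enorm a ^+ 2 * enorm b)).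
    by rewrite aa; field; rewrite !gt_eqF.
  by rewrite /dot /cross; field; rewrite !gt_eqF.
have d1 := is_derive_fst _ _ _ dc1; have d2 := is_derive_snd _ _ _ dc1.
rewrite {1}/cross {1}/dot; derive_tac.
  by move: a0; rewrite /dot -/a => /gt_eqF ->.
rewrite -!/a; have a0' := a0; rewrite /dot in a0'.
rewrite /cross /dot; field.
by rewrite !gt_eqF// ltr_pwDl ?sqr_ge0// exprn_gt0.
Unshelve. all: end_near. Qed.

End regular_curves.

(** * Curves in polar coordinates *)

Section polar_geometry.
Context {R : realType}.

Lemma is_derive_polar (rho alpha : R -> R) (s a b : R) :
  is_derive s 1 rho a -> is_derive s 1 alpha b ->
  is_derive s 1 (fun x => polar (rho x) (alpha x))
    (a * cos (alpha s) - rho s * sin (alpha s) * b,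
     a * sin (alpha s) + rho s * cos (alpha s) * b).
Proof. by move=> da db; apply: is_derive_pair; derive_tac; ring. Qed.

Lemma is_derive_polar_curve (r : R * R -> R) (t p a : R) :
  is_derive p 1 (fun q => r (q, t)) a ->
  is_derive p 1 (polar_curve r t)
    (a * cos (pi - p) + r (p, t) * sin (pi - p),
     a * sin (pi - p) - r (p, t) * cos (pi - p)).
Proof.
move=> da; have db : is_derive p 1 (fun q : R => pi - q) (- 1).
  by derive_tac; rewrite add0r.
apply: is_derive_eq (is_derive_polar _ _ _ _ _ da db) _.
by congr (_, _); ring.
Qed.

Lemma enorm_polar_velocity (rho a x : R) :
  enorm (a * cos x + rho * sin x, a * sin x - rho * cos x) =
  Num.sqrt (rho ^+ 2 + a ^+ 2).
Proof.
rewrite /enorm /dot /=; congr Num.sqrt.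
transitivity ((rho ^+ 2 + a ^+ 2) * (cos x ^+ 2 + sin x ^+ 2)); first by ring.
by rewrite cos2Dsin2 mulr1.
Qed.

Lemma cos_sin_atan_div (rho a : R) : 0 < rho ->
  cos (atan (a / rho)) = rho / Num.sqrt (rho ^+ 2 + a ^+ 2) /\
  sin (atan (a / rho)) = a / Num.sqrt (rho ^+ 2 + a ^+ 2).
Proof.
move=> rho0; set s := Num.sqrt _.
have s0 : 0 < s by rewrite sqrtr_gt0 ltr_pwDl ?sqr_ge0// exprn_gt0.
have s2 : s ^+ 2 = rho ^+ 2 + a ^+ 2.
  by rewrite sqr_sqrtr// addr_ge0 ?sqr_ge0.
have c : cos (atan (a / rho)) = rho / s.
  rewrite cos_atan (_ : 1 + _ = (s / rho) ^+ 2).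
    by rewrite sqrtr_sqr ger0_norm ?invf_div// divr_ge0 ?ltW.
  transitivity ((rho ^+ 2 + a ^+ 2) / rho ^+ 2); first by field; rewrite gt_eqF.
  by rewrite -s2 expr_div_n.
split=> //; have := atanK (a / rho); rewrite /tan c => E.
apply: (mulIf (x := (rho / s)^-1)); first by rewrite invr_eq0 mulf_neq0 ?invr_eq0 ?gt_eqF.
by rewrite E; field; rewrite !gt_eqF.
Qed.

Section polar_slice.
Variables (r rp : R * R -> R) (t lo hi : R).
Hypothesis r_gt0 : forall p, lo < p < hi -> 0 < r (p, t).
Hypothesis dr : forall p : R, lo < p < hi ->
  is_derive p 1 (fun q => r (q, t)) (rp (p, t)).
Hypothesis crp : forall p : R, lo < p < hi ->
  {for p, continuous (fun q => rp (q, t))}.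

(** The curve runs clockwise, so at constant radius the tangent has angle [(pi - q) - pi / 2]; a
    radial velocity [rp] turns it outwards by [atan (rp / r)]. *)
Lemma polar_curve_angle (p : R) : lo < p < hi ->
  tangent_angle (polar_curve r t) p
    (fun q => pi / 2 - q + atan (rp (q, t) / r (q, t))).
Proof.
move=> pI; have : \forall q \near p, lo < q < hi.
  by have := @near_in_itvoo R lo hi p; rewrite in_itv/= => /(_ pI); apply: filterS => q; rewrite in_itv.
apply: filterS => q qI; have r0 := r_gt0 _ qI; have drq := dr _ qI.
have cr := is_derive_continuous _ _ _ drq; have c1 := crp _ qI.
split.
  by cont_tac; [exact: continuous_atan|rewrite gt_eqF].
rewrite (unit_tangentE _ _ _ (is_derive_polar_curve _ _ _ _ drq)) enorm_polar_velocity /=.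
have [c s] := cos_sin_atan_div _ (rp (q, t)) r0.
have -> : pi / 2 - q + atan (rp (q, t) / r (q, t)) =
    (pi - q) + atan (rp (q, t) / r (q, t)) - pi / 2 by field.
rewrite cosBpihalf sinBpihalf; move: (pi - q) => x; rewrite cosD sinD c s.
by congr (_, _); ring.
Qed.

Lemma polar_curve_curvature (p d : R) : lo < p < hi ->
  is_derive p 1 (fun q => atan (rp (q, t) / r (q, t))) d ->
  geodesic_curvature (polar_curve r t) p =
    (d - 1) / Num.sqrt (r (p, t) ^+ 2 + rp (p, t) ^+ 2).
Proof.
move=> pI dA; have dpsi : is_derive p 1
    (fun q => pi / 2 - q + atan (rp (q, t) / r (q, t))) (d - 1).
  by derive_tac; ring.
rewrite (geodesic_curvatureE _ _ _ _ (polar_curve_angle _ pI) dpsi).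
by rewrite (speedE _ _ _ (is_derive_polar_curve _ _ _ _ (dr _ pI))) enorm_polar_velocity.
Qed.

Lemma polar_curve_support (p : R) : lo < p < hi ->
  support_function (polar_curve r t) p =
    r (p, t) ^+ 2 / Num.sqrt (r (p, t) ^+ 2 + rp (p, t) ^+ 2).
Proof.
move=> pI; rewrite (support_functionE _ _ _ (is_derive_polar_curve _ _ _ _ (dr _ pI))).
rewrite enorm_polar_velocity /cross /polar_curve /polar /=; congr (_ / _).
transitivity (r (p, t) ^+ 2 * (cos (pi - p) ^+ 2 + sin (pi - p) ^+ 2)); first by ring.
by rewrite cos2Dsin2 mulr1.
Qed.

End polar_slice.

(* Reversing the orientation changes the sign of both the normal and the
   curvature, so the flow equation does not see the sign of [Phi1 u]. *)
Lemma flow_equation_reparam (U : set R) (c b b1 : R -> R * R) (Phi Phi1 psi : R -> R)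
    (u d : R) (X : R * R) :
  open U -> U u -> (forall v, U v -> c v = b (Phi v)) ->
  (forall v : R, U v -> is_derive v 1 Phi (Phi1 v)) ->
  (forall v, U v -> is_derive (Phi v) 1 b (b1 (Phi v))) ->
  (forall v, U v -> b1 (Phi v) != 0) ->
  {for u, continuous Phi1} -> Phi1 u != 0 ->
  tangent_angle b (Phi u) psi -> is_derive (Phi u) 1 psi d ->
  dot X (unit_normal c u) = - geodesic_curvature c u ->
  dot X (unit_normal b (Phi u)) = - (d / speed b (Phi u)).
Proof.
move=> oU Uu cb dPhi db b1n0 cPhi1 Phi1u angle dpsi.
have dc v : U v -> is_derive v 1 c ((b1 (Phi v)).1 * Phi1 v, (b1 (Phi v)).2 * Phi1 v).
  move=> Uv; have e : \forall w \near v, (fun w => ((b (Phi w)).1, (b (Phi w)).2)) w = c w.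
    by apply: filterS (open_nbhs_nbhs (conj oU Uv)) => w Uw; rewrite cb//; case: (b _).
  apply: near_eq_is_derive e _; apply: is_derive_pair.
    exact: is_derive_compf (is_derive_fst _ _ _ (db v Uv)) (dPhi v Uv).
  exact: is_derive_compf (is_derive_snd _ _ _ (db v Uv)) (dPhi v Uv).
have norm_scale (q : R * R) k : enorm (q.1 * k, q.2 * k) = `|k| * enorm q.
  rewrite /enorm -sqrtr_sqr -sqrtrM ?sqr_ge0//; congr Num.sqrt.
  by rewrite /dot /=; ring.
have cPhi : {for u, continuous Phi} by exact: is_derive_continuous (dPhi u Uu).
have near_angle : \forall v \near u, {for Phi v, continuous psi} /\
    unit_tangent b (Phi v) = (cos (psi (Phi v)), sin (psi (Phi v))).
  exact: (cPhi _ angle).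
have near_U : \forall v \near u, U v by exact: open_nbhs_nbhs.
have dpsiPhi : is_derive u 1 (fun v => psi (Phi v)) (d * Phi1 u).
  exact: is_derive_compf dpsi (dPhi u Uu).
have en := enorm_gt0 _ (b1n0 u Uu).
rewrite (unit_normalE _ _ _ (dc u Uu)) (unit_normalE _ _ _ (db u Uu)) /=.
rewrite (speedE _ _ _ (db u Uu)) norm_scale /dot /=.
move: Phi1u; rewrite neq_lt => /orP[neg|pos].
- have near_neg : \forall v \near u, Phi1 v < 0 by exact: (cvgr_lt _ cPhi1).
  (* The reversed parametrisation has the opposite tangent, hence the shift by [pi]. *)
  have anglec : tangent_angle c u (fun v => psi (Phi v) + pi).
    near=> v; have Uv : U v by near: v; exact: near_U.
    have [cpsi T] : {for Phi v, continuous psi} /\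
        unit_tangent b (Phi v) = (cos (psi (Phi v)), sin (psi (Phi v))).
      by near: v; exact: near_angle.
    have k0 : Phi1 v < 0 by near: v; exact: near_neg.
    have cP := is_derive_continuous _ _ _ (dPhi v Uv).
    split; first by cont_tac.
    have env := enorm_gt0 _ (b1n0 v Uv).
    move: T; rewrite (unit_tangentE _ _ _ (dc v Uv)) (unit_tangentE _ _ _ (db v Uv)).
    rewrite norm_scale cosDpi sinDpi ltr0_norm// => -[<- <-] /=.
    by congr (_, _); field; rewrite gt_eqF// lt_eqF.
  have dpsic : is_derive u 1 (fun v => psi (Phi v) + pi) (d * Phi1 u).
    by derive_tac; rewrite addr0.
  rewrite (geodesic_curvatureE _ _ _ _ anglec dpsic) (speedE _ _ _ (dc u Uu)) norm_scale.
  rewrite ltr0_norm// => E; apply/eqP; rewrite -eqr_opp opprK; apply/eqP.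
  transitivity (- (d * Phi1 u / (- Phi1 u * enorm (b1 (Phi u))))).
    by rewrite -E; field; rewrite gt_eqF// lt_eqF.
  by field; rewrite gt_eqF// lt_eqF.
- have near_pos : \forall v \near u, 0 < Phi1 v by exact: (cvgr_gt _ cPhi1).
  have anglec : tangent_angle c u (fun v => psi (Phi v)).
    near=> v; have Uv : U v by near: v; exact: near_U.
    have [cpsi T] : {for Phi v, continuous psi} /\
        unit_tangent b (Phi v) = (cos (psi (Phi v)), sin (psi (Phi v))).
      by near: v; exact: near_angle.
    have k0 : 0 < Phi1 v by near: v; exact: near_pos.
    have cP := is_derive_continuous _ _ _ (dPhi v Uv).
    split; first by cont_tac.
    have env := enorm_gt0 _ (b1n0 v Uv).
    move: T; rewrite (unit_tangentE _ _ _ (dc v Uv)) (unit_tangentE _ _ _ (db v Uv)).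
    rewrite norm_scale gtr0_norm// => -[<- <-] /=.
    by congr (_, _); field; rewrite !gt_eqF.
  rewrite (geodesic_curvatureE _ _ _ _ anglec dpsiPhi) (speedE _ _ _ (dc u Uu)) norm_scale.
  rewrite gtr0_norm// => E.
  transitivity (- (d * Phi1 u / (Phi1 u * enorm (b1 (Phi u))))).
    by rewrite -E; field; rewrite !gt_eqF.
  by field; rewrite !gt_eqF.
Unshelve. all: end_near. Qed.

(** Joint differentiability of [r] is not assumed, only partial derivatives with [rp] jointly
    continuous at one point. By the mean value theorem at fixed [s], the increment in the first
    variable is [rp (x, s) * (Phi s - Phi t)] with [x] between [Phi t] and [Phi s]. *)
Lemma chain_rule_slice (r rp : R * R -> R) (Phi : R -> R) (lo hi t a b : R) :
  lo < Phi t < hi -> 0 < t ->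
  (forall p s : R, lo < p < hi -> 0 < s ->
    is_derive p 1 (fun q => r (q, s)) (rp (p, s))) ->
  {for (Phi t, t), continuous rp} ->
  is_derive t 1 Phi a -> is_derive t 1 (fun s => r (Phi t, s)) b ->
  is_derive t 1 (fun s => r (Phi s, s)) (rp (Phi t, t) * a + b).
Proof.
move=> PI t0 dr crp dPhi drt; set p0 := Phi t in PI crp drt *.
pose Q s := r (Phi s, s) - r (p0, s).
suff dQ : is_derive t 1 Q (rp (p0, t) * a).
  have -> : (fun s => r (Phi s, s)) = (fun s => Q s + r (p0, s)).
    by apply/funext => s; rewrite /Q subrK.
  exact: is_derive_addf.
(* The Caratheodory slope of [Q] with respect to [Phi]; where [Phi s] returns to [p0] the quotient
   is void and the limit value is inserted, which keeps [k] continuous at [t]. *)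
pose k s := if Phi s == p0 then rp (p0, t) else Q s / (Phi s - p0).
have kE s : Q s = k s * (Phi s - p0).
  rewrite /k /Q; case: eqP => [->|/eqP h]; first by rewrite !subrr mulr0.
  by rewrite divfK// subr_eq0.
have [G [GE cG Ga]] := (@is_derive1_caratheodory _ Phi t a).1 dPhi.
apply/(@is_derive1_caratheodory _ Q); exists (fun s => k s * G s).
have kt : k t = rp (p0, t) by rewrite /k eqxx.
split; last by rewrite kt Ga.
  by move=> s; rewrite {2}/Q subrr subr0 kE GE mulrA.
suff ck : {for t, continuous k} by cont_tac.
apply/cvgrPdist_lt => eps eps0; rewrite kt.
have [[U V] /= [Unb Vnb] HUV] := (cvgrPdist_lt _ _).1 crp eps eps0.
have [e1 /= e10 He1] := Unb; have [e2 /= e20 He2] := Vnb.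
have pnear : \forall p \near p0, lo < p < hi.
  by have := @near_in_itvoo R lo hi p0; rewrite in_itv/= => /(_ PI); apply: filterS => q; rewrite in_itv.
have cPhi : {for t, continuous Phi} by exact: is_derive_continuous dPhi.
have Pnear : \forall s \near t, lo < Phi s < hi by exact: (cPhi _ pnear).
near=> s.
have s0 : 0 < s by near: s; exact: lt_nbhsr.
have sV : V s by near: s; exact: Vnb.
have sPhi : `|p0 - Phi s| < e1.
  by near: s; exact: ((cvgrPdist_lt _ _).1 cPhi e1 e10).
have sP : lo < Phi s < hi by near: s; exact: Pnear.
rewrite /k; case: eqP => [_|/eqP neq]; first by rewrite subrr normr0.
have dist x : Num.min p0 (Phi s) <= x <= Num.max p0 (Phi s) ->
    lo < x < hi /\ `|p0 - x| < e1.
  move: PI sP sPhi => /andP[? ?] /andP[? ?]; rewrite ltr_norml => /andP[? ?].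
  case: (leP p0 (Phi s)) => ? /andP[? ?].
    by split; [|rewrite ltr_norml]; apply/andP; split; lra.
  by split; [|rewrite ltr_norml]; apply/andP; split; lra.
have [x [xI xE]] : exists x, Num.min p0 (Phi s) <= x <= Num.max p0 (Phi s) /\
    Q s = rp (x, s) * (Phi s - p0).
  have [le|/ltW le] := leP p0 (Phi s).
    have [|x xI E] := @mean_value _ (fun q => r (q, s)) (fun q => rp (q, s)) _ _ le.
      move=> x xI; apply: dr => //.
      by have [] := dist x; rewrite ?(min_idPl le) ?(max_idPr le).
    by exists x.
  have [|x xI E] := @mean_value _ (fun q => r (q, s)) (fun q => rp (q, s)) _ _ le.
    move=> x xI; apply: dr => //.
    by have [] := dist x; rewrite ?(min_idPr le) ?(max_idPl le).
  by exists x; split=> //; rewrite /Q; lra.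
rewrite xE mulfK ?subr_eq0//.
have [_ xe] := dist x xI.
by apply: (HUV (x, s)); split => //=; exact: He1.
Unshelve. all: end_near. Qed.

End polar_geometry.

(** * The flow in polar coordinates *)

Section smooth_flow.
Context {R : realType} (I : set R) (gamma : R * R -> R * R).
Hypothesis openI : open I.
Hypothesis smooth : smooth_on (I `*` open_time (+oo%E : \bar R)) gamma.

Definition space_velocity := 'D_((1, 0) : R * R) gamma.
Definition space_acceleration := 'D_((1, 0) : R * R) space_velocity.
Definition time_velocity := 'D_((0, 1) : R * R) gamma.

Lemma flow_derivatives (u t : R) : I u -> 0 < t ->
  [/\ is_derive u 1 (fun v => gamma (v, t)) (space_velocity (u, t)),
      is_derive u 1 (fun v => space_velocity (v, t)) (space_acceleration (u, t)),
      {for u, continuous (fun v => space_acceleration (v, t))} &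
      is_derive t 1 (fun s => gamma (u, s)) (time_velocity (u, t))].
Proof.
move=> Iu t0; pose B := I `*` [set s : R | 0 < s].
have oB : open B by apply: open_setX => //; exact: open_gt.
have BA : B `<=` I `*` open_time (+oo%E : \bar R).
  by move=> [v s] [/= Iv s0]; split => //=; split => //; rewrite ltry.
have But : B (u, t) by [].
have [_ [d1 [_ [d2 [c2 _] _]] _]] := smooth_on_Ck _ _ _ 2 oB BA smooth.
have [d1u d1t] := d1 _ But; have [d2u _] := d2 _ But.
split.
- exact: derive_slice_fst.
- exact: derive_slice_fst.
- apply: (@continuous_compf _ _ _ space_acceleration (fun v => (v, t))).
    exact: c2.
  by cont_tac.
- exact: derive_slice_snd.
Qed.

End smooth_flow.

Section polar_representation.
Context {R : realType} (beta : R) (I : set R) (gamma : R * R -> R * R) (r : R * R -> R).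
Hypothesis beta_bound : 0 < beta <= pi.
Hypothesis graph : polar_graph_flow beta I gamma r.

(** At the usual polar angle [theta] the quotient is [cot theta = tan (phi - pi / 2)], where
    [phi = pi - theta]. The formula is smooth on the open upper half-plane, which contains the
    curves at positive times because [beta <= pi]. *)
Definition polar_angle (q : R * R) : R := pi / 2 + atan (q.1 / q.2).

Lemma polar_angleK (rho phi : R) : 0 < rho -> 0 < phi < pi ->
  polar_angle (polar rho (pi - phi)) = phi.
Proof.
move=> rho0 pI; rewrite /polar_angle /polar /=.
have s0 : 0 < sin phi by exact: sin_gt0_pi.
have -> : rho * cos (pi - phi) / (rho * sin (pi - phi)) = tan (phi - pi / 2).
  rewrite /tan sinBpihalf cosBpihalf cosB sinB cospi sinpi.
  by field; rewrite !gt_eqF// mul0r sub0r mulN1r opprK s0.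
rewrite tanK; first by ring.
by move: pI => /andP[? ?]; rewrite in_itv/=; apply/andP; split; lra.
Qed.

Lemma polar_angle_flow (u t : R) : I u -> 0 < t ->
  [/\ 0 < polar_angle (gamma (u, t)) < beta,
      gamma (u, t) = polar_curve r t (polar_angle (gamma (u, t))) &
      0 < (gamma (u, t)).2].
Proof.
move=> Iu t0; have [r0 E] := graph t t0.
have : (time_slice gamma t @` I) (gamma (u, t)) by exists u.
rewrite E => -[phi /=]; rewrite in_itv/= => pI <-.
have rp := r0 _ pI; have pI' : 0 < phi < pi.
  by move: pI beta_bound => /andP[? ?] /andP[? ?]; apply/andP; split; lra.
rewrite polar_angleK//; split => //=.
rewrite mulr_gt0// sin_gt0_pi//.
by move: pI' => /andP[? ?]; apply/andP; split; lra.
Qed.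

Lemma polar_angle_onto (phi t : R) : 0 < phi < beta -> 0 < t ->
  exists u, [/\ I u, polar_angle (gamma (u, t)) = phi &
    gamma (u, t) = polar_curve r t phi].
Proof.
move=> pI t0; have [r0 E] := graph t t0.
have : (polar_curve r t @` `]0, beta[) (polar_curve r t phi) by exists phi.
rewrite -E => -[u Iu e]; exists u; split => //.
rewrite -/(time_slice gamma t u) e /polar_curve polar_angleK//; first exact: r0.
by move: pI beta_bound => /andP[? ?] /andP[? ?]; apply/andP; split; lra.
Qed.

(** The polar angle is measured clockwise, hence [cross d (c u)] and not [cross (c u) d]. *)
Lemma is_derive_polar_angle (c : R -> R * R) (u : R) (d : R * R) :
  0 < (c u).2 -> is_derive u 1 c d ->
  is_derive u 1 (fun v => polar_angle (c v)) (cross d (c u) / dot (c u) (c u)).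
Proof.
move=> y0 dc; have d1 := is_derive_fst _ _ _ dc; have d2 := is_derive_snd _ _ _ dc.
have n0 : 0 < dot (c u) (c u).
  by rewrite dot_gt0//; apply: contraTneq y0 => ->; rewrite ltxx.
rewrite /polar_angle; derive_tac; first by rewrite gt_eqF.
move: n0; rewrite /cross /dot /= => n0; field.
by rewrite !gt_eqF.
Qed.

Hypothesis flow : uniformly_proper_solution I +oo%E (closed_time +oo%E) gamma.

(* In polar coordinates, the flow equation says that half the rate of
   [r ^+ 2] is the rate of turning of the tangent: [r * r_t = psi']. *)
Lemma radial_evolution (rp : R * R -> R) (p t rt d : R) : 0 < p < beta -> 0 < t ->
  (forall q s : R, 0 < q < beta -> 0 < s ->
    is_derive q 1 (fun x => r (x, s)) (rp (q, s))) ->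
  {for (p, t), continuous rp} ->
  (forall q : R, 0 < q < beta -> {for q, continuous (fun x => rp (x, t))}) ->
  is_derive t 1 (fun s => r (p, s)) rt ->
  is_derive p 1 (fun q => atan (rp (q, t) / r (q, t))) d ->
  r (p, t) * rt = d - 1.
Proof.
move=> pI t0 dr crp crps drt dA.
have [u [Iu up gup]] := polar_angle_onto p t pI t0.
have [oI _ _] := ups_space flow.
have sm := ups_smooth flow.
have r_gt0 q : 0 < q < beta -> 0 < r (q, t) by exact: (graph t t0).1.
have dgu v s : I v -> 0 < s -> is_derive v 1 (fun x => gamma (x, s)) (space_velocity gamma (v, s)).
  by move=> Iv s0; have [h _ _ _] := flow_derivatives _ _ oI sm v s Iv s0; exact: h.
have [_ _ _ dgt] := flow_derivatives _ _ oI sm u t Iu t0.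
pose Phi v s := polar_angle (gamma (v, s)).
pose Phi1 v := cross (space_velocity gamma (v, t)) (gamma (v, t)) /
  dot (gamma (v, t)) (gamma (v, t)).
have dPhi v : I v -> is_derive v 1 (fun x => Phi x t) (Phi1 v).
  move=> Iv; have [_ _ y0] := polar_angle_flow v t Iv t0.
  exact: (is_derive_polar_angle (fun x => gamma (x, t)) v _ y0 (dgu v t Iv t0)).
have [_ _ yu] := polar_angle_flow u t Iu t0.
have dPhit := is_derive_polar_angle (fun s => gamma (u, s)) t _ yu dgt.
set Phit := _ / _ in dPhit.
have cPhi1 : {for u, continuous Phi1}.
  have [_ da _ _] := flow_derivatives _ _ oI sm u t Iu t0.
  have c1 := is_derive_continuous _ _ _ (is_derive_fst _ _ _ da).
  have c2 := is_derive_continuous _ _ _ (is_derive_snd _ _ _ da).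
  have c3 := is_derive_continuous _ _ _ (is_derive_fst _ _ _ (dgu u t Iu t0)).
  have c4 := is_derive_continuous _ _ _ (is_derive_snd _ _ _ (dgu u t Iu t0)).
  rewrite /Phi1 /cross /dot; cont_tac.
  suff : 0 < dot (gamma (u, t)) (gamma (u, t)) by rewrite /dot => /gt_eqF ->.
  by rewrite dot_gt0//; apply: contraTneq yu => ->; rewrite ltxx.
pose b1 q := (rp (q, t) * cos (pi - q) + r (q, t) * sin (pi - q),
  rp (q, t) * sin (pi - q) - r (q, t) * cos (pi - q)).
have PI v : I v -> 0 < Phi v t < beta.
  by move=> Iv; have [] := polar_angle_flow v t Iv t0.
have db v : I v -> is_derive (Phi v t) 1 (polar_curve r t) (b1 (Phi v t)).
  move=> Iv; apply: is_derive_polar_curve; apply: dr => //; exact: PI.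
have s0 q : 0 < q < beta -> 0 < Num.sqrt (r (q, t) ^+ 2 + rp (q, t) ^+ 2).
  by move=> qI; rewrite sqrtr_gt0 ltr_pwDl ?sqr_ge0// exprn_gt0// r_gt0.
have b1n0 v : I v -> b1 (Phi v t) != 0.
  move=> Iv; have := s0 _ (PI v Iv); rewrite -(enorm_polar_velocity _ _ (pi - Phi v t)).
  by rewrite -/(b1 _); apply: contraTneq => ->; rewrite /enorm /dot !mulr0 addr0 sqrtr0 ltxx.
have [gn0 csf] := ups_csf flow Iu t0 (ltry _).
(* By the chain rule the velocity of the slice is [Phi1 u] times that of the polar curve, and the
   flow is regular. *)
have Phi1u : Phi1 u != 0.
  have e : \forall w \near u, (fun w => ((polar_curve r t (Phi w t)).1, (polar_curve r t (Phi w t)).2)) w = time_slice gamma t w.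
    apply: filterS (open_nbhs_nbhs (conj oI Iu)) => w Iw.
    have [_ E _] := polar_angle_flow w t Iw t0.
    by rewrite /Phi -E /time_slice; case: (gamma _).
  have D := is_derive_pair _ _ _ _ _
    (is_derive_compf _ (fun v => Phi v t) u _ _ (is_derive_fst _ _ _ (db u Iu)) (dPhi u Iu))
    (is_derive_compf _ (fun v => Phi v t) u _ _ (is_derive_snd _ _ _ (db u Iu)) (dPhi u Iu)).
  have := is_derive_derive1 _ _ _ (near_eq_is_derive e D) => E.
  by apply: contraNneq gn0 => z; rewrite E z !mulr0.
have Pu : Phi u t = p by exact: up.
have dpsi : is_derive (Phi u t) 1
    (fun q => pi / 2 - q + atan (rp (q, t) / r (q, t))) (d - 1).
  by rewrite Pu; derive_tac; ring.
have drp q : 0 < q < beta -> is_derive q 1 (fun x => r (x, t)) (rp (q, t)).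
  by move=> qI; exact: dr.
have angle := polar_curve_angle r rp t 0 beta r_gt0 drp crps (Phi u t) (PI u Iu).
have gE v : I v -> time_slice gamma t v = polar_curve r t (Phi v t).
  by move=> Iv; have [] := polar_angle_flow v t Iv t0.
have := flow_equation_reparam I (time_slice gamma t) (polar_curve r t) b1
  (fun v => Phi v t) Phi1 _ u (d - 1) _ oI Iu gE dPhi db b1n0 cPhi1 Phi1u angle dpsi csf.
rewrite (speedE _ _ _ (db u Iu)) (unit_normalE _ _ _ (db u Iu)) enorm_polar_velocity.
have PIu : 0 < Phi u t < beta by exact: PI.
have crpu : {for (Phi u t, t), continuous rp} by rewrite Pu.
have drtu : is_derive t 1 (fun s => r (Phi u t, s)) rt by rewrite Pu.
(* Following a fixed [u], both radius and angle move: the velocity is [Phit] times the tangent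
   vector [b1] plus [rt] times the radial direction. Only the latter survives the product with the
   normal. *)
have drho := chain_rule_slice r rp (Phi u) 0 beta t _ _ PIu t0 dr crpu dPhit drtu.
have dal : is_derive t 1 (fun s => pi - Phi u s) (- Phit).
  by derive_tac; rewrite add0r.
have e : \forall s \near t, polar (r (Phi u s, s)) (pi - Phi u s) = gamma (u, s).
  near=> s; have s1 : 0 < s by near: s; exact: lt_nbhsr.
  by have [_ E _] := polar_angle_flow u s Iu s1; rewrite [RHS]E.
have := is_derive_derive1 _ _ _ (near_eq_is_derive e (is_derive_polar _ _ _ _ _ drho dal)).
move=> ->; rewrite Pu /dot /b1 /=.
have sp0 := s0 _ pI; move: sp0; set sp := Num.sqrt _ => sp0.
have := cos2Dsin2 (pi - p); set C := cos _; set S := sin _ => CS E.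
apply: (mulIf (x := sp^-1)); first by rewrite invr_eq0 gt_eqF.
apply: oppr_inj; rewrite -E -[in LHS](mulr1 rt) -CS.
by field; rewrite gt_eqF.
Unshelve. all: end_near. Qed.

End polar_representation.

(** * The ends and the initial curve *)

Section radial_ends.
Context {R : realType} (beta : R) (I : set R) (gamma : R * R -> R * R) (r : R * R -> R).
Hypothesis beta_bound : 0 < beta <= pi.
Hypothesis graph : polar_graph_flow beta I gamma r.
Hypothesis flow : uniformly_proper_solution I +oo%E (closed_time +oo%E) gamma.

(** Properness makes the set of parameters that [gamma] sends into the box compact, so [ell] attains
    a minimum along it; this minimum is positive because the times are at least [a > 0]. *)
Lemma proper_lower_bound (ell : R * R -> R) (a tau rho : R) : 0 < a ->
  continuous ell -> (forall u t, I u -> 0 < t -> 0 < ell (gamma (u, t))) ->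
  exists2 m, 0 < m & forall u t, I u -> a <= t <= tau ->
    `|(gamma (u, t)).1| <= rho -> `|(gamma (u, t)).2| <= rho ->
    m <= ell (gamma (u, t)).
Proof.
move=> a0 cell ell0.
pose K := `[- rho, rho]%classic `*` `[- rho, rho]%classic : set (R * R).
have cK : compact K by apply: compact_setX; exact: segment_compact.
have sub : `[a, tau] `<=` closed_time (+oo%E : \bar R).
  by move=> t; rewrite /= in_itv/= => /andP[at_ _]; split; [lra|rewrite ltry].
pose S := (I `*` `[a, tau]%classic) `&` gamma @^-1` K.
have cS : compact S by exact: (ups_proper flow sub).
have cg : {within S, continuous (ell \o gamma)}.
  apply: within_continuous_comp; first by move=> x _; exact: cell.
  apply: continuous_subspaceW (ups_continuous flow).
  by move=> [u t] [[/= Iu tI] _]; split => //=; exact: sub.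
have [S0|/set0P S0] := eqVneq S set0.
  exists 1 => // u t Iu tI g1 g2; have : S (u, t).
    by split; [|split]; rewrite //= in_itv/= // -ler_norml.
  by rewrite S0.
have [[u0 t0] + Hmin] := compact_EVT_min S0 cS cg.
rewrite inE => -[[/= Iu0 +] _]; rewrite in_itv/= => /andP[t0a _].
exists (ell (gamma (u0, t0))); first by apply: ell0 => //; exact: lt_le_trans t0a.
move=> u t Iu tI g1 g2; apply: (Hmin (u, t)); rewrite inE.
by split; [|split]; rewrite //= in_itv/= // -ler_norml.
Qed.

Lemma sin_le_id (x : R) : 0 <= x -> sin x <= x.
Proof.
move=> x0; have := @mean_value_le _ sin cos 0 x 1 x0.
rewrite sin0 !subr0 mul1r; by apply=> y _; exact: cos_le1.
Qed.

(** Take for [ell] the distance to the line through the boundary ray, equal to [r * sin d] at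
    angular distance [d] from it. While the curve is in a bounded box, this is at least some
    [m > 0], but also at most [rho * d]; so a bounded radius is impossible for small [d]. *)
Lemma radius_unbounded_at_ends (L a tau : R) : 0 < a ->
  exists2 d0, 0 < d0 & forall d t, 0 < d < d0 -> a <= t <= tau ->
    L <= r (d, t) ^+ 2 /\ L <= r (beta - d, t) ^+ 2.
Proof.
move=> a0; have /andP[beta0 betapi] := beta_bound.
(* With this choice [r ^+ 2 < L] implies [r <= rho]. *)
pose rho := Num.max 1 L; have rho1 : 1 <= rho by rewrite le_max lexx.
have rhoL : L <= rho by rewrite le_max lexx orbT.
have side (ell : R * R -> R) (f : R -> R) : continuous ell ->
    (forall d t, 0 < d < beta -> ell (polar_curve r t (f d)) = r (f d, t) * sin d) ->
    (forall d, 0 < d < beta -> 0 < f d < beta) ->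
    (forall d, f (f d) = d) ->
    exists2 d0, 0 < d0 & forall d t, 0 < d < d0 -> d < beta -> a <= t <= tau ->
      L <= r (f d, t) ^+ 2.
  move=> cell ellE fI ff.
  have ell0 u t : I u -> 0 < t -> 0 < ell (gamma (u, t)).
    move=> Iu t0; have [pI -> _] := polar_angle_flow _ _ _ _ beta_bound graph u t Iu t0.
    have fpI := fI _ pI.
    rewrite -{1}[polar_angle _]ff ellE// mulr_gt0//.
      by rewrite ff; exact: (graph t t0).1.
    by apply: sin_gt0_pi; move: fpI => /andP[? ?]; apply/andP; split; lra.
  have [m m0 Hm] := proper_lower_bound ell a tau rho a0 cell ell0.
  exists (m / rho); first by rewrite divr_gt0//; lra.
  move=> d t /andP[d0 dm] db tI; have dI : 0 < d < beta by rewrite d0.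
  have t0 : 0 < t by move: tI => /andP[? ?]; lra.
  have r0 : 0 < r (f d, t) by apply: (graph t t0).1; exact: fI.
  rewrite leNgt; apply/negP => rL.
  have rrho : r (f d, t) <= rho.
    have [r1|r1] := leP (r (f d, t)) 1; first by lra.
    apply: le_trans rhoL; apply: le_trans (ltW rL).
    by rewrite expr2 ler_peMl// ltW.
  have [u [Iu _ gE]] := polar_angle_onto _ _ _ _ beta_bound graph (f d) t (fI _ dI) t0.
  have norm_le x y : `|y| <= 1 -> `|x * y| <= `|x|.
    by move=> y1; rewrite normrM ler_piMr.
  have := Hm u t Iu tI; rewrite gE ellE//= => /(_ _ _) H.
  have : m <= r (f d, t) * sin d.
    apply: H; rewrite (le_trans _ rrho)// -[leRHS]gtr0_norm// norm_le//.
      by rewrite ler_norml cos_geN1 cos_le1.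
    by rewrite ler_norml sin_geN1 sin_le1.
  have : r (f d, t) * sin d <= rho * d.
    by rewrite ler_pM ?sin_le_id ?(ltW r0) ?(ltW d0)// sin_ge0_pi//; apply/andP; split; lra.
  by move: dm; rewrite ltr_pdivlMr; [lra|lra].
have [||||d1 d10 H1] := side (fun q => q.2) id.
- exact: continuous_sndf.
- by move=> d t _; rewrite /polar_curve /polar /= sinB cospi sinpi; ring.
- by [].
- by [].
(* Signed distance to the line at angle [pi - beta], positive on the side of the wedge. *)
have [||||d2 d20 H2] := side (fun q => - q.1 * sin beta - q.2 * cos beta) (fun d => beta - d).
- move=> q.
  suff : {for q, continuous (fun q : R * R => - q.1 * sin beta - q.2 * cos beta)} by [].
  by cont_tac.
- move=> d t _; rewrite /polar_curve /polar /= !(cosB, sinB) cospi sinpi.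
  rewrite [in RHS](_ : sin d = sin d * (cos beta ^+ 2 + sin beta ^+ 2)); first by ring.
  by rewrite cos2Dsin2 mulr1.
- by move=> d /andP[? ?]; apply/andP; split; lra.
- by move=> d; ring.
exists (Num.min beta (Num.min d1 d2)); first by rewrite !lt_min beta0 d10.
move=> d t /andP[d0]; rewrite !lt_min => /andP[db /andP[dd1 dd2]] tI.
by split; [apply: (H1 d t)|apply: (H2 d t)]; rewrite ?d0.
Qed.

(** The part of the initial curve described by [r (_, 0)] lies in the image of the compact segment
    [[u1, u2]]. The norm on the plane is the sup norm, so the squared radius is bounded by two
    squares. *)
Lemma initial_radius_bound (u1 u2 : R) : I u1 -> I u2 ->
  time_slice gamma 0 @` `]u1, u2[ = polar_curve r 0 @` `]0, beta[ ->
  exists M, forall p, 0 < p < beta -> r (p, 0) ^+ 2 <= M.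
Proof.
move=> Iu1 Iu2 E; have [_ itvI _] := ups_space flow.
have cK : compact (`[u1, u2]%classic `*` `[0, 0]%classic : set (R * R)).
  by apply: compact_setX; exact: segment_compact.
have cg : {within `[u1, u2]%classic `*` `[0, 0]%classic, continuous gamma}.
  apply: continuous_subspaceW (ups_continuous flow).
  move=> [u t] [/=]; rewrite !in_itv/= => uI /andP[t0 t0']; split=> /=.
    exact: itvI uI.
  by split; [|rewrite ltry].
have [M [_ HM]] := compact_bounded (continuous_compact cg cK).
pose B := `|M| + 1; exists (B ^+ 2 + B ^+ 2) => p pI.
have : (polar_curve r 0 @` `]0, beta[) (polar_curve r 0 p) by exists p.
rewrite -E => -[u /=]; rewrite in_itv/= => /andP[u1u uu2] gE.
have B0 : 0 <= B by rewrite addr_ge0.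
have : `|gamma (u, 0)| <= B.
  apply: HM; first by rewrite (le_lt_trans (ler_norm M))// ltrDl.
  by exists (u, 0) => //; split => /=; rewrite in_itv/= ?lexx// !ltW.
rewrite -/(time_slice gamma 0 u) gE prod_normE ge_max => /andP[/= h1 h2].
have sq x : `|x| <= B -> x ^+ 2 <= B ^+ 2 by move=> h; rewrite -(real_normK (num_real x)) ler_sqr ?nnegrE.
have := sq _ h1; have := sq _ h2.
rewrite !exprMn => h3 h4.
rewrite -[leLHS]mulr1 -(cos2Dsin2 (pi - p)) mulrDr.
by rewrite lerD.
Qed.

End radial_ends.

Lemma curvature_le_support {R : realType} (beta : R) (r : R * R -> R) (I : set R)
    (gamma : R * R -> R * R) : 0 < beta <= pi ->
  (forall phi t, 0 < phi < beta -> 0 <= t -> 0 < r (phi, t)) ->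
  smooth_on (`]0, beta[ `*` `[0, +oo[) (r : R * R -> R^o) ->
  radial_coordinate_of beta I gamma r ->
  forall phi t, 0 < phi < beta -> 0 < t ->
    geodesic_curvature (polar_curve r t) phi
      <= 1 / (2 * t) * support_function (polar_curve r t) phi.
Proof.
move=> beta_bound r_gt0 smooth [[flow _] graph [u1 [u2 [[Iu1 Iu2 _ _ _] init]]]].
pose B : set (R * R) := `]0, beta[%classic `*` [set s : R | 0 < s].
have oB : open B by apply: open_setX; [exact: itv_open|exact: open_gt].
have BA : B `<=` `]0, beta[ `*` `[0, +oo[.
  by move=> [q s] [/= qI s0]; split => //=; rewrite in_itv/= ltW.
have [cr [d1 [crp [d2 _ _]] [crt _]]] := smooth_on_Ck _ _ _ 2 oB BA smooth.
have inB (q s : R) : 0 < q < beta -> 0 < s -> B (q, s) by move=> qI s0; split; rewrite //= in_itv.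
pose rp := 'D_((1, 0) : R * R) (r : R * R -> R^o).
pose rt := 'D_((0, 1) : R * R) (r : R * R -> R^o).
pose rpp := 'D_((1, 0) : R * R) rp.
have drp (q s : R) : 0 < q < beta -> 0 < s -> is_derive q 1 (fun x => r (x, s)) (rp (q, s)).
  by move=> qI s0; have [h _] := d1 _ (inB q s qI s0); exact: derive_slice_fst h.
have drt (q s : R) : 0 < q < beta -> 0 < s -> is_derive s 1 (fun x => r (q, x)) (rt (q, s)).
  by move=> qI s0; have [_ h] := d1 _ (inB q s qI s0); exact: derive_slice_snd h.
have drpp (q s : R) : 0 < q < beta -> 0 < s -> is_derive q 1 (fun x => rp (x, s)) (rpp (q, s)).
  by move=> qI s0; have [h _] := d2 _ (inB q s qI s0); exact: derive_slice_fst h.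
have crpJ (q s : R) : 0 < q < beta -> 0 < s -> {for (q, s), continuous (rp : R * R -> R)}.
  by move=> qI s0; exact: crp _ (inB q s qI s0).
have crtJ (q s : R) : 0 < q < beta -> 0 < s -> {for (q, s), continuous (rt : R * R -> R)}.
  by move=> qI s0; exact: crt _ (inB q s qI s0).
have crJ (q s : R) : 0 < q < beta -> 0 < s -> {for (q, s), continuous r}.
  by move=> qI s0; exact: cr _ (inB q s qI s0).
pose d q := (rpp q * r q - rp q ^+ 2) / (r q ^+ 2 + rp q ^+ 2).
have dA (q s : R) : 0 < q < beta -> 0 < s ->
    is_derive q 1 (fun x => atan (rp (x, s) / r (x, s))) (d (q, s)).
  move=> qI s0; have h1 := drp q s qI s0; have h2 := drpp q s qI s0.
  have r0 := r_gt0 q s qI (ltW s0).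
  derive_tac; first by rewrite gt_eqF.
  have : 0 < r (q, s) ^+ 2 + rp (q, s) ^+ 2 by rewrite ltr_pwDl ?sqr_ge0// exprn_gt0.
  by rewrite /d => n0; field; rewrite !gt_eqF.
have evol (q s : R) : 0 < q < beta -> 0 < s -> r (q, s) * rt (q, s) = d (q, s) - 1.
  move=> qI s0; have crps x : 0 < x < beta -> {for x, continuous (fun x => rp (x, s))}.
    by move=> xI; exact: is_derive_continuous (drpp x s xI s0).
  exact: (radial_evolution _ _ _ _ beta_bound graph flow rp q s _ _ qI s0
    drp (crpJ q s qI s0) crps (drt q s qI s0) (dA q s qI s0)).
pose w q := r q ^+ 2; pose wt q := 2 * r q * rt q; pose wp q := 2 * r q * rp q.
have angleE (q s : R) : 0 < q < beta -> 0 < s ->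
    radial_angle w wp (q, s) = atan (rp (q, s) / r (q, s)).
  move=> qI s0; rewrite /radial_angle /w /wp; congr atan.
  by field; rewrite gt_eqF// r_gt0// ltW.
have sflow : squared_radius_flow beta w wt wp.
  split=> q s qI s0.
  - by rewrite exprn_gt0// r_gt0// ltW.
  - have h := drt q s qI s0; rewrite /w /wt; derive_tac; ring.
  - have h := drp q s qI s0; rewrite /w /wp; derive_tac; ring.
  - have -> : wt (q, s) / 2 + 1 = d (q, s).
      by have := evol q s qI s0; rewrite /wt; lra.
    have e : \forall x \near q, atan (rp (x, s) / r (x, s)) = radial_angle w wp (x, s).
      have : q \in `]0, beta[ by rewrite in_itv.
      move=> /near_in_itvoo; apply: filterS => x; rewrite in_itv/= => xI.
      by rewrite angleE.
    exact: near_is_derive e (dA q s qI s0).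
  - have h := crJ q s qI s0.
    suff : {for (q, s), continuous (fun x => r x * r x)} by [].
    by cont_tac.
  - by have h := crJ q s qI s0; have h' := crtJ q s qI s0; rewrite /wt; cont_tac.
(* Smoothness up to the initial time enters here: the local extension [g] is continuous at [(p, 0)]
   and agrees with [r] for [t >= 0]. *)
have cont0 (p eps : R) : 0 < p < beta -> 0 < eps ->
    exists2 del, 0 < del & forall q t, `|q - p| < del -> 0 <= t < del ->
      `|w (q, t) - w (p, 0)| < eps.
  move=> pI eps0; have A0 : (`]0, beta[%classic `*` `[(0 : R), +oo[%classic) (p, 0).
    by split; rewrite /= in_itv/= ?lexx.
  have [U [g [oU U0 Cg rg]]] := smooth _ A0.
  have [cg _] := Cg 0%N; have cg0 : {for (p, 0), continuous (g : R * R -> R)} by exact: cg.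
  have cg2 : {for (p, 0), continuous (fun x => (g : R * R -> R) x * (g : R * R -> R) x)}.
    by cont_tac.
  have near_g : \forall x \near ((p, 0) : R * R), U x /\ `|g (p, 0) * g (p, 0) - g x * g x| < eps.
    apply: filterS2 (open_nbhs_nbhs (conj oU U0)) ((cvgrPdist_lt _ _).1 cg2 eps eps0).
    by move=> x ? ?.
  have near_p : \forall x \near p, 0 < x < beta.
    have : p \in `]0, beta[ by rewrite in_itv.
    by move=> /near_in_itvoo; apply: filterS => x; rewrite in_itv.
  have [[V W] /= [[e1 /= e10 H1] [e2 /= e20 H2]] HVW] := near_g.
  have [e3 /= e30 H3] := near_p.
  exists (Num.min e1 (Num.min e2 e3)); first by rewrite !lt_min e10 e20.
  move=> q t; rewrite !lt_min => /andP[q1 /andP[_ q3]] /andP[t0 /andP[_ /andP[t2 _]]].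
  have qI : 0 < q < beta by apply: H3; rewrite /= distrC.
  have [|Uqt] := HVW (q, t).
    split=> /=; first by apply: H1; rewrite /= distrC.
    by apply: H2; rewrite /= sub0r normrN ger0_norm.
  rewrite distrC /w !expr2 !rg//; split; rewrite /= in_itv//= ?lexx//.
  by rewrite t0.
have [M HM] := initial_radius_bound _ _ _ _ flow _ _ Iu1 Iu2 init.
have bound0 (p : R) : 0 < p < beta -> 0 < w (p, 0) <= M.
  by move=> pI; rewrite exprn_gt0 ?r_gt0 ?lexx//= HM.
move=> p t pI t0.
have rate := squared_radius_rate _ _ _ _ sflow cont0 _ bound0
  (radius_unbounded_at_ends _ _ _ _ beta_bound graph flow) p t pI t0.
have rpos (q : R) : 0 < q < beta -> 0 < r (q, t) by move=> qI; exact/r_gt0/ltW.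
have drpt (q : R) : 0 < q < beta -> is_derive q 1 (fun x => r (x, t)) (rp (q, t)).
  by move=> qI; exact: drp.
have crpt (q : R) : 0 < q < beta -> {for q, continuous (fun x => rp (x, t))}.
  by move=> qI; exact: is_derive_continuous (drpp q t qI t0).
rewrite (polar_curve_curvature _ _ _ _ _ rpos drpt crpt _ _ pI (dA p t pI t0)).
rewrite (polar_curve_support _ _ _ _ _ drpt _ pI) -evol// mulrA.
rewrite ler_pM2r; last first.
  by rewrite invr_gt0 sqrtr_gt0 ltr_pwDl ?sqr_ge0// exprn_gt0// rpos.
rewrite div1r ler_pdivlMl ?mulr_gt0//.
by move: rate; rewrite /w /wt; lra.
Qed.

(** * Self-similar solutions *)

Section linear_ode.
Context {R : realType}.

(** Gronwall's argument: if [M] bounds [k] in absolute value between [u] and [v], then [f ^+ 2]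
    times [expR (- (2 * M) * x)] is nonincreasing and [f ^+ 2] times [expR (2 * M * x)] is
    nondecreasing. The zero spreads to the right by the first and to the left by the second. *)
Lemma linear_ode_zero (I : set R) (f k : R -> R) (u v : R) : is_interval I ->
  (forall x : R, I x -> is_derive x 1 f (k x * f x)) ->
  (forall x : R, I x -> {for x, continuous k}) ->
  I u -> I v -> f u = 0 -> f v = 0.
Proof.
move=> itvI df ck Iu Iv fu.
pose lo := Num.min u v; pose hi := Num.max u v.
have sub x : lo <= x <= hi -> I x.
  rewrite /lo /hi; case: (leP u v) => _; [exact: itvI Iu Iv x|exact: itvI Iv Iu x].
(* The one-variable bound is read off a rectangle with degenerate second side [[0, 0]]. *)
have [|M M0 HM] := @rectangle_bound R (fun q => k q.1) lo hi 0 0.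
  move=> p t pI _; apply: continuous_compf; last exact: continuous_fstf.
  exact/ck/sub.
have kM x : lo <= x <= hi -> - M <= k x <= M.
  by move=> xI; rewrite -ler_norml; apply: (HM x 0) => //; rewrite lexx.
have dE (c x : R) : I x ->
    is_derive x 1 (fun y => f y ^+ 2 * expR (c * y)) ((2 * k x + c) * (f x ^+ 2 * expR (c * x))).
  move=> Ix; have h := df x Ix.
  have he : is_derive x 1 (fun y => expR (c * y)) (expR (c * x) * c).
    apply: (is_derive_compf _ (fun y => c * y)).
    by derive_tac; rewrite mulr0 addr0.
  by derive_tac; ring.
have pos (c x : R) : 0 <= f x ^+ 2 * expR (c * x) by rewrite mulr_ge0 ?sqr_ge0 ?expR_ge0.
suff [c] : exists c, f v ^+ 2 * expR (c * v) <= 0.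
  move=> h; have /eqP : f v ^+ 2 * expR (c * v) = 0 by apply/le_anti; rewrite h pos.
  by rewrite mulf_eq0 sqrf_eq0 (gt_eqF (expR_gt0 _)) orbF => /eqP.
have [uv|/ltW vu] := leP u v.
- exists (- (2 * M)).
  have := @mean_value_le _ (fun y => f y ^+ 2 * expR (- (2 * M) * y))
    (fun x => (2 * k x + - (2 * M)) * (f x ^+ 2 * expR (- (2 * M) * x))) u v 0 uv.
  rewrite fu expr0n mul0r mul0r subr0; apply.
    by move=> x xI; apply/dE/sub; rewrite /lo /hi (min_idPl uv) (max_idPr uv).
  move=> x xI; rewrite mulr_le0_ge0//.
  by have := kM x; rewrite /lo /hi (min_idPl uv) (max_idPr uv) => /(_ xI) /andP[]; lra.
- exists (2 * M).
  have := @mean_value_ge _ (fun y => f y ^+ 2 * expR (2 * M * y))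
    (fun x => (2 * k x + 2 * M) * (f x ^+ 2 * expR (2 * M * x))) v u 0 vu.
  rewrite fu expr0n mul0r mul0r sub0r oppr_ge0; apply.
    by move=> x xI; apply/dE/sub; rewrite /lo /hi (min_idPr vu) (max_idPl vu).
  move=> x xI; rewrite mulr_ge0//.
  by have := kM x; rewrite /lo /hi (min_idPr vu) (max_idPl vu) => /(_ xI) /andP[]; lra.
Qed.

End linear_ode.

Section tangency.
Context {R : realType}.

(* A curve inside the trace of an embedded curve is tangent to it: the
   embedding forces its points to have parameters close to [u]. *)
Lemma tangent_to_embedded (I : set R) (c q : R -> R * R) (u t : R) (v d : R * R) :
  open I -> I u -> embedded_on I c -> is_derive u 1 c v -> v != 0 ->
  is_derive t 1 q d -> q t = c u -> (\forall s \near t, (c @` I) (q s)) ->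
  cross d v = 0.
Proof.
move=> oI Iu [_ _ emb] dc v0 dq qt qI.
have g0 := dot_gt0 _ v0.
have lin (f : R -> R * R) (s : R) (e : R * R) : is_derive s 1 f e ->
    is_derive s 1 (fun x => cross (f x) v) (cross e v) /\
    is_derive s 1 (fun x => dot (f x) v) (dot e v).
  move=> df; have d1 := is_derive_fst _ _ _ df; have d2 := is_derive_snd _ _ _ df.
  by rewrite /cross /dot; split; derive_tac; ring.
(* Caratheodory slopes of the components across and along [v]: [G], [H] for [c] and [L], [M] for
   [q]. At a common point [q s = c x], the ratio of [L s] to [M s] is that of [G x] to [H x], which
   is small for [x] near [u] since [G u = 0 < H u]. *)
have [/is_derive1_caratheodory [G [GE cG Gu]] /is_derive1_caratheodory [H [HE cH Hu]]] := lin _ _ _ dc.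
have [/is_derive1_caratheodory [L [LE cL Lt]] /is_derive1_caratheodory [M [ME cM Mt]]] := lin _ _ _ dq.
have cq1 := is_derive_continuous _ _ _ (is_derive_fst _ _ _ dq).
have cq2 := is_derive_continuous _ _ _ (is_derive_snd _ _ _ dq).
have cq : {for t, continuous q}.
  have -> : q = (fun s => ((q s).1, (q s).2)) by apply/funext => s; case: (q s).
  exact: continuous_pairf.
have key eps : 0 < eps -> `|L t| <= eps * `|M t|.
  move=> eps0; rewrite leNgt; apply/negP => lt_M.
  have near_c : \forall x \near u, I x /\ (`|G x| < eps * (dot v v / 2) /\ dot v v / 2 < H x).
    have cnG : {for u, continuous (fun x => `|G x|)}.
      by cont_tac; exact: norm_continuous.
    near=> x; split; first by near: x; exact: open_nbhs_nbhs.
    split.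
      near: x; apply: (cvgr_lt _ cnG).
      rewrite Gu (_ : cross v v = 0) ?normr0 ?mulr_gt0 ?divr_gt0//.
      by rewrite /cross; ring.
    by near: x; apply: (cvgr_gt _ cH); rewrite Hu; lra.
  have [W [oW Wu] WI] : exists2 W : set R, open W /\ W u &
      W `<=` [set x | I x /\ (`|G x| < eps * (dot v v / 2) /\ dot v v / 2 < H x)].
    by have := near_c; rewrite -[X in X -> _]/(nbhs u _) nbhsE => -[W [oW Wu] WI]; exists W.
  have [V oV VE] := emb W oW (fun x Wx => (WI x Wx).1).
  have Vq : V (q t).
    have : (c @` W) (c u) by exists u.
    by rewrite VE qt => -[].
  have near_V : \forall s \near t, V (q s).
    by apply: cq; exact: open_nbhs_nbhs.
  have near_L : \forall s \near t, eps * `|M s| < `|L s|.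
    have cf : {for t, continuous (fun s => `|L s| - eps * `|M s|)}.
      by cont_tac; exact: norm_continuous.
    have := cvgr_gt _ cf 0; rewrite subr_gt0 => /(_ _ lt_M).
    by apply: filterS => s; rewrite subr_gt0.
  have [s [sV [sI [sL st]]]] : exists s, V (q s) /\ ((c @` I) (q s) /\
      (eps * `|M s| < `|L s| /\ s != t)).
    near (t^') => s; exists s; split; [|split; [|split]]; near: s.
    - exact: nbhs_dnbhs near_V.
    - exact: nbhs_dnbhs qI.
    - exact: nbhs_dnbhs near_L.
    - exact: nbhs_dnbhs_neq.
  have [x Wx cx] : (c @` W) (q s) by rewrite VE.
  have [_ [Gx Hx]] := WI x Wx.
  have e1 : G x * (x - u) = L s * (s - t) by rewrite -GE -LE cx qt.
  have e2 : H x * (x - u) = M s * (s - t) by rewrite -HE -ME cx qt.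
  have st0 : 0 < `|s - t| by rewrite normr_gt0 subr_eq0.
  have : `|G x| * `|x - u| <= eps * (`|H x| * `|x - u|).
    rewrite mulrA ler_wpM2r// (le_trans (ltW Gx))// ler_pM2l// (le_trans (ltW Hx))//.
    exact: ler_norm.
  rewrite -!normrM e1 e2 !normrM mulrA ler_pM2r//.
  by rewrite leNgt sL.
have : `|L t| <= 0.
  rewrite leNgt; apply/negP => Lt0.
  have M1 : 0 < `|M t| + 1 by rewrite ltr_wpDl.
  (* For this [eps] the bound reads [|L t| <= |L t| / 2], up to a factor at most 1; adding 1 to
     [|M t|] covers [M t = 0]. *)
  have := key (`|L t| / (2 * (`|M t| + 1))) ltac:(by rewrite divr_gt0// mulr_gt0).
  have -> : `|L t| / (2 * (`|M t| + 1)) * `|M t| = `|L t| / 2 * (`|M t| / (`|M t| + 1)).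
    by field; rewrite gt_eqF.
  have : `|M t| / (`|M t| + 1) <= 1 by rewrite ler_pdivrMr//; lra.
  by nra.
by rewrite normr_le0 Lt => /eqP.
Unshelve. all: end_near. Qed.

End tangency.

(** [V], [g], [a], [y] stand for velocity in time, tangent vector, acceleration and position. As
    [V - y / 2] is tangential, [y / 2] may replace [V] in the flow equation; the conclusion is
    [2 * kappa = D] without denominators. *)
Lemma tangential_velocity_curvature {R : realType} (V g a y : R * R) : g != 0 ->
  cross (V.1 - y.1 / 2, V.2 - y.2 / 2) g = 0 ->
  dot V (g.2 / enorm g, - (g.1 / enorm g)) = - (cross g a / dot g g / enorm g) ->
  2 * cross g a = dot g g * cross g y.
Proof.
move=> gn0; have en := enorm_gt0 _ gn0; have g0 := dot_gt0 _ gn0.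
move=> tang E.
have E2 : V.1 * g.2 - V.2 * g.1 = - (cross g a / dot g g).
  apply: (mulIf (x := (enorm g)^-1)); first by rewrite invr_eq0 gt_eqF.
  by rewrite mulNr -E /dot /=; ring.
have -> : cross g y = 2 * (cross g a / dot g g).
  by rewrite -[cross g a / _]opprK -E2; move: tang; rewrite /cross /=; lra.
by field; rewrite gt_eqF.
Qed.

(** Expanding in the frame of [g] and its rotation gives [cross a y * dot g g = dot a g * cross g y
    - dot y g * cross g a]. Since [cross a y] is the derivative of [cross g y] along the curve, this
    is the linear equation for the support function. *)
Lemma cross_acceleration {R : realType} (g a y : R * R) : g != 0 ->
  2 * cross g a = dot g g * cross g y ->
  cross a y = (dot a g / dot g g - dot y g / 2) * cross g y.
Proof.
move=> gn0 E; have g0 := dot_gt0 _ gn0.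
apply: (mulIf (x := dot g g)); first by rewrite gt_eqF.
have -> : (dot a g / dot g g - dot y g / 2) * cross g y * dot g g =
    dot a g * cross g y - dot y g * (dot g g * cross g y) / 2.
  by field; rewrite gt_eqF.
by rewrite -E /cross /dot; field.
Qed.

(** * Regularity of the radius of a self-similar curve *)

Section expander.
Context {R : realType} (beta : R) (I : set R) (c c1 c2 : R -> R * R) (r : R -> R).
Hypothesis beta0 : 0 < beta.
Hypotheses (openI : open I) (itvI : is_interval I).
Hypothesis dc : forall v : R, I v -> is_derive v 1 c (c1 v).
Hypothesis dc1 : forall v : R, I v -> is_derive v 1 c1 (c2 v).
Hypothesis cc2 : forall v : R, I v -> {for v, continuous c2}.
Hypothesis c1_neq0 : forall v, I v -> c1 v != 0.
Hypothesis curvature : forall v, I v ->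
  2 * cross (c1 v) (c2 v) = dot (c1 v) (c1 v) * cross (c1 v) (c v).
Hypothesis upper : forall v, I v -> 0 < (c v).2.
Hypothesis angle_itv : forall v, I v -> 0 < polar_angle (c v) < beta.
Hypothesis r_gt0 : forall p, 0 < p < beta -> 0 < r p.
Hypothesis onto : forall p, 0 < p < beta -> exists u,
  [/\ I u, polar_angle (c u) = p & c u = polar (r p) (pi - p)].

(* The left-hand side solves a linear differential equation, so if it vanished
   anywhere the curve would lie on a single ray. *)
Lemma cross_position_neq0 v : I v -> cross (c1 v) (c v) != 0.
Proof.
have b0 := beta0; have b2 : 0 < beta / 2 < beta by apply/andP; split; lra.
have b3 : 0 < beta / 3 < beta by apply/andP; split; lra.
have b23 : beta / 2 <> beta / 3 by lra.
move=> Iv; apply/eqP => D0.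
pose D x := cross (c1 x) (c x).
pose k x := dot (c2 x) (c1 x) / dot (c1 x) (c1 x) - dot (c x) (c1 x) / 2.
have dD x : I x -> is_derive x 1 D (k x * D x).
  move=> Ix.
  have h1 := is_derive_fst _ _ _ (dc x Ix); have h2 := is_derive_snd _ _ _ (dc x Ix).
  have h3 := is_derive_fst _ _ _ (dc1 x Ix); have h4 := is_derive_snd _ _ _ (dc1 x Ix).
  have g0 := dot_gt0 _ (c1_neq0 x Ix).
  have -> : k x * D x = cross (c2 x) (c x).
    exact/esym/(cross_acceleration _ _ _ (c1_neq0 x Ix) (curvature x Ix)).
  by rewrite /D /cross; derive_tac; ring.
have ck x : I x -> {for x, continuous k}.
  move=> Ix.
  have h1 := is_derive_continuous _ _ _ (is_derive_fst _ _ _ (dc x Ix)).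
  have h2 := is_derive_continuous _ _ _ (is_derive_snd _ _ _ (dc x Ix)).
  have h3 := is_derive_continuous _ _ _ (is_derive_fst _ _ _ (dc1 x Ix)).
  have h4 := is_derive_continuous _ _ _ (is_derive_snd _ _ _ (dc1 x Ix)).
  have h5 : {for x, continuous (fun y => (c2 y).1)}.
    by apply: continuous_compf (cc2 x Ix); exact: continuous_fstf.
  have h6 : {for x, continuous (fun y => (c2 y).2)}.
    by apply: continuous_compf (cc2 x Ix); exact: continuous_sndf.
  rewrite /k /dot; cont_tac.
  by move: (dot_gt0 _ (c1_neq0 x Ix)); rewrite /dot => /gt_eqF ->.
have Dzero x : I x -> D x = 0.
  by move=> Ix; exact: (linear_ode_zero I D k v x itvI dD ck Iv Ix D0).
have dangle x : I x -> is_derive x 1 (fun y => polar_angle (c y)) 0.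
  move=> Ix; have y0 := upper x Ix.
  by have := is_derive_polar_angle c x (c1 x) y0 (dc x Ix); rewrite -/(D x) Dzero// mul0r.
have const x y : I x -> I y -> x <= y -> polar_angle (c x) = polar_angle (c y).
  move=> Ix Iy xy.
  have [z zI] := @mean_value _ (fun y => polar_angle (c y)) (fun=> 0) x y xy
    (fun z zI => dangle z (itvI _ _ Ix Iy z zI)).
  by rewrite mul0r => /eqP; rewrite subr_eq0 => /eqP.
(* The polar angle is constant, yet it takes two different values. *)
have [x [Ix xE _]] := onto (beta / 2) b2.
have [y [Iy yE _]] := onto (beta / 3) b3.
apply: b23; rewrite -xE -yE; have [xy|/ltW yx] := leP x y; first exact: const.
exact/esym/const.
Qed.

(** The polar angle [Phi] has nonvanishing derivative on an interval, so it is injective and its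
    inverse [Psi] is differentiable. Then [r] is [rad \o Psi] with derivative [slope \o Psi], and
    [slope] is differentiable because [c] has two derivatives. *)
Lemma expander_radius_derivatives : exists rp rpp : R -> R, forall p : R, 0 < p < beta ->
  is_derive p 1 r (rp p) /\ is_derive p 1 rp (rpp p).
Proof.
pose Phi x := polar_angle (c x).
pose Phi1 x := cross (c1 x) (c x) / dot (c x) (c x).
have dPhi x : I x -> is_derive x 1 Phi (Phi1 x).
  move=> Ix; have y0 := upper x Ix.
  exact: is_derive_polar_angle c x (c1 x) y0 (dc x Ix).
have cc0 x : I x -> 0 < dot (c x) (c x).
  move=> Ix; have y0 := upper x Ix.
  by rewrite dot_gt0//; apply: contraTneq y0 => ->; rewrite ltxx.
have Phi1_neq0 x : I x -> Phi1 x != 0.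
  move=> Ix; rewrite mulf_neq0 ?cross_position_neq0// invr_eq0 gt_eqF//; exact: cc0.
have Phi_lt x y : I x -> I y -> x < y -> Phi x <> Phi y.
  move=> Ix Iy xy; have [z zI E] := @mean_value _ Phi Phi1 x y (ltW xy)
    (fun z zI => dPhi z (itvI _ _ Ix Iy z zI)).
  move=> e; move: E; rewrite e subrr => /esym/eqP.
  by rewrite mulf_eq0 (negbTE (Phi1_neq0 z (itvI _ _ Ix Iy z zI))) /= subr_eq0 gt_eqF.
have Phi_inj x y : I x -> I y -> Phi x = Phi y -> x = y.
  move=> Ix Iy e; case: (ltgtP x y) => // xy; first by case: (Phi_lt x y).
  by case: (Phi_lt y x).
have /choice[Psi HPsi] : forall p, exists x, 0 < p < beta ->
    [/\ I x, Phi x = p & c x = polar (r p) (pi - p)].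
  move=> p; have [pI|pI] := pselect (0 < p < beta); last by exists 0.
  by have [x [? ? ?]] := onto p pI; exists x.
have PhiI x : I x -> 0 < Phi x < beta.
  exact: angle_itv.
have PsiK x : I x -> Psi (Phi x) = x.
  by move=> Ix; have [h1 h2 _] := HPsi _ (PhiI x Ix); exact: Phi_inj.
have dPsi p : 0 < p < beta -> is_derive p 1 Psi (Phi1 (Psi p))^-1.
  move=> pI; have [Ix xE _] := HPsi p pI.
  rewrite -{1}xE; apply: (@is_derive_inverse _ Phi Psi).
  - by apply: filterS (open_nbhs_nbhs (conj openI Ix)) => x; exact: PsiK.
  - by apply: filterS (open_nbhs_nbhs (conj openI Ix)) => x Iy; exact: is_derive_continuous (dPhi x Iy).
  - exact: dPhi.
  - exact: Phi1_neq0.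
pose rad x := Num.sqrt (dot (c x) (c x)).
pose drad x := dot (c x) (c1 x) / rad x.
have rad0 x : I x -> 0 < rad x by move=> Ix; rewrite sqrtr_gt0 cc0.
have dot_derive x : I x -> is_derive x 1 (fun y => dot (c y) (c y)) (2 * dot (c x) (c1 x)).
  move=> Ix; have h1 := is_derive_fst _ _ _ (dc x Ix).
  have h2 := is_derive_snd _ _ _ (dc x Ix); rewrite /dot; derive_tac; ring.
have d_rad x : I x -> is_derive x 1 rad (drad x).
  move=> Ix; have h := dot_derive x Ix; rewrite /rad; derive_tac; first exact: cc0.
  rewrite /drad -/(rad x); field; rewrite gt_eqF//; exact: rad0.
have radE p : 0 < p < beta -> rad (Psi p) = r p.
  move=> pI; have [_ _ E] := HPsi p pI; rewrite /rad E /dot /polar /=.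
  have r0 := r_gt0 p pI.
  rewrite (_ : _ + _ = r p ^+ 2 * (cos (pi - p) ^+ 2 + sin (pi - p) ^+ 2)); last by ring.
  by rewrite cos2Dsin2 mulr1 sqrtr_sqr gtr0_norm.
pose slope x := drad x / Phi1 x.
have [dslope Hslope] : exists ds : R -> R, forall x : R, I x -> is_derive x 1 slope (ds x).
  suff : forall x : R, exists d, I x -> is_derive x 1 slope d by move=> /choice[ds ?]; exists ds.
  move=> x; have [Ix|nIx] := pselect (I x); last by exists 0.
  have h1 := is_derive_fst _ _ _ (dc x Ix); have h2 := is_derive_snd _ _ _ (dc x Ix).
  have h3 := is_derive_fst _ _ _ (dc1 x Ix); have h4 := is_derive_snd _ _ _ (dc1 x Ix).
  have h5 := d_rad x Ix; have n1 := Phi1_neq0 x Ix; have n2 := rad0 x Ix.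
  have n3 := cc0 x Ix.
  eexists=> _; rewrite /slope /drad /Phi1 /dot /cross; derive_tac.
  all: try reflexivity.
  all: rewrite ?gt_eqF//.
exists (fun p => slope (Psi p)), (fun p => dslope (Psi p) * (Phi1 (Psi p))^-1) => p pI.
have [Ix _ _] := HPsi p pI; have dP := dPsi p pI.
split; last exact: is_derive_compf (Hslope _ Ix) dP.
have e : \forall q \near p, rad (Psi q) = r q.
  have : p \in `]0, beta[ by rewrite in_itv.
  by move=> /near_in_itvoo; apply: filterS => q; rewrite in_itv/=; exact: radE.
apply: near_is_derive e _; exact: is_derive_compf (d_rad _ Ix) dP.
Qed.

End expander.

(** * Equality for self-similar solutions *)

Section wedge.
Context {R : realType} (beta : R) (I : set R) (gamma : R * R -> R * R) (r : R * R -> R).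
Hypothesis beta_bound : 0 < beta <= pi.
Hypothesis graph : polar_graph_flow beta I gamma r.
Hypothesis flow : uniformly_proper_solution I +oo%E (closed_time +oo%E) gamma.
Hypothesis similar : self_similar I gamma.

Let openI : open I. Proof. by have [] := ups_space flow. Qed.
Let smooth := ups_smooth flow.

(** Scaling preserves polar angles, and each angle determines a single point of the curve. *)
Lemma self_similar_radius (phi s : R) : 0 < phi < beta -> 0 < s ->
  r (phi, s) = Num.sqrt s * r (phi, 1).
Proof.
move=> pI s0; have pI' : 0 < phi < pi.
  by move: pI beta_bound => /andP[? ?] /andP[? ?]; apply/andP; split; lra.
have [u [Iu _ gE]] := polar_angle_onto _ _ _ _ beta_bound graph phi s pI s0.
have : (time_slice gamma s @` I) (gamma (u, s)) by exists u.
rewrite (similar s s0) => -[p [v Iv <-]]; rewrite /time_slice.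
have [qI gv _] := polar_angle_flow _ _ _ _ beta_bound graph v 1 Iv ltr01.
rewrite gv gE; move: (polar_angle _) qI => q qI.
have qI' : 0 < q < pi.
  by move: qI beta_bound => /andP[? ?] /andP[? ?]; apply/andP; split; lra.
have r1 := (graph 1 ltr01).1 q qI; have rs := (graph s s0).1 phi pI.
have ss : 0 < Num.sqrt s by rewrite sqrtr_gt0.
have -> : Num.sqrt s *: polar_curve r 1 q = polar (Num.sqrt s * r (q, 1)) (pi - q).
  by congr (_, _); rewrite /GRing.scale /= mulrA.
move=> E; have qp : q = phi.
  by rewrite -(polar_angleK _ q (mulr_gt0 ss r1) qI') E polar_angleK.
rewrite qp in E; move: E => [_ /mulIf] -> //.
by rewrite gt_eqF// sin_gt0_pi//; move: pI' => /andP[? ?]; apply/andP; split; lra.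
Qed.

Let c := time_slice gamma 1.
Let c1 v := space_velocity gamma (v, 1).
Let c2 v := space_acceleration gamma (v, 1).

Lemma wedge_velocity_neq0 v : I v -> c1 v != 0.
Proof.
move=> Iv; have [h _] := ups_csf flow Iv ltr01 (ltry _).
have [dc _ _ _] := flow_derivatives _ _ openI smooth v 1 Iv ltr01.
by move: h; rewrite (is_derive_derive1 _ _ _ dc).
Qed.

(* Self-similarity turns the flow equation into [2 * kappa = D] at time 1. *)
Lemma self_similar_curvature v : I v ->
  2 * cross (c1 v) (c2 v) = dot (c1 v) (c1 v) * cross (c1 v) (c v).
Proof.
move=> Iv; have [dc dc1 _ dt] := flow_derivatives _ _ openI smooth v 1 Iv ltr01.
have n0 := wedge_velocity_neq0 v Iv.
have dt1 := is_derive_fst _ _ _ dt; have dt2 := is_derive_snd _ _ _ dt.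
set gt := time_velocity gamma (v, 1) in dt dt1 dt2.
(* Scaled back by [sqrt s], the path of a fixed [v] stays in the curve at time 1. Its velocity at
   time 1, [gt - c v / 2], is therefore tangent to that curve. *)
pose q s := ((gamma (v, s)).1 / Num.sqrt s, (gamma (v, s)).2 / Num.sqrt s).
have s1 : Num.sqrt (1 : R) = 1 := sqrtr1 R.
have dq : is_derive (1 : R) 1 q (gt.1 - (c v).1 / 2, gt.2 - (c v).2 / 2).
  apply: is_derive_pair; derive_tac => //; rewrite ?s1 ?oner_neq0//;
    by rewrite /c /time_slice; field.
have q1 : q 1 = c v by rewrite /q s1 !divr1 /c /time_slice; case: (gamma _).
have qI : \forall s \near (1 : R), (c @` I) (q s).
  near=> s; have s0 : 0 < s by near: s; exact: lt_nbhsr.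
  have : (time_slice gamma s @` I) (gamma (v, s)) by exists v.
  rewrite (similar s s0) => -[p pI E].
  have -> // : q s = p.
  rewrite /q -E /GRing.scale /=; case: p {pI E} => p1 p2 /=.
  by congr (_, _); rewrite mulrAC divff ?mul1r// gt_eqF// sqrtr_gt0.
have emb : embedded_on I c by apply: (ups_embedded flow); split; rewrite ?ltry.
have tang := tangent_to_embedded _ _ _ _ _ _ _ openI Iv emb dc n0 dq q1 qI.
have near_c : \forall w \near v, {for w, continuous c1} /\ is_derive w 1 c (c1 w).
  apply: filterS (open_nbhs_nbhs (conj openI Iv)) => w Iw.
  have [dw dw1 _ _] := flow_derivatives _ _ openI smooth w 1 Iw ltr01.
  split; last exact: dw.
  have h1 := is_derive_continuous _ _ _ (is_derive_fst _ _ _ dw1).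
  have h2 := is_derive_continuous _ _ _ (is_derive_snd _ _ _ dw1).
  have -> : c1 = (fun s => ((c1 s).1, (c1 s).2)) by apply/funext => s; case: (c1 s).
  exact: continuous_pairf.
have [psi angle dpsi] := regular_curve_angle _ _ _ _ near_c n0 dc1.
have [_] := ups_csf flow Iv ltr01 (ltry _).
rewrite (is_derive_derive1 _ _ _ dt) -/gt -/c.
rewrite (geodesic_curvatureE _ _ _ _ angle dpsi) (speedE _ _ _ dc).
rewrite (unit_normalE _ _ _ dc).
exact: (tangential_velocity_curvature gt (c1 v) (c2 v) (c v) n0 tang).
Unshelve. all: end_near. Qed.

(** A wedge solution specifies [r] only through the curves as sets; this supplies the
    differentiability in the angle needed to compute curvature in polar form. *)
Lemma wedge_radius_derivatives : exists rp rpp : R -> R, forall p : R, 0 < p < beta ->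
  is_derive p 1 (fun q => r (q, 1)) (rp p) /\ is_derive p 1 rp (rpp p).
Proof.
have [_ itvI _] := ups_space flow; have /andP[beta0 _] := beta_bound.
apply: (expander_radius_derivatives beta I c c1 c2 (fun q => r (q, 1)) beta0 openI itvI).
- by move=> v Iv; have [h _ _ _] := flow_derivatives _ _ openI smooth v 1 Iv ltr01; exact: h.
- by move=> v Iv; have [_ h _ _] := flow_derivatives _ _ openI smooth v 1 Iv ltr01; exact: h.
- by move=> v Iv; have [_ _ h _] := flow_derivatives _ _ openI smooth v 1 Iv ltr01; exact: h.
- exact: wedge_velocity_neq0.
- exact: self_similar_curvature.
- by move=> v Iv; have [_ _ h] := polar_angle_flow _ _ _ _ beta_bound graph v 1 Iv ltr01.
- by move=> v Iv; have [h _ _] := polar_angle_flow _ _ _ _ beta_bound graph v 1 Iv ltr01.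
- exact: (graph 1 ltr01).1.
- by move=> p pI; exact: polar_angle_onto _ _ _ _ beta_bound graph p 1 pI ltr01.
Qed.

Lemma wedge_curvature (phi t : R) : 0 < phi < beta -> 0 < t ->
  geodesic_curvature (polar_curve r t) phi =
  1 / (2 * t) * support_function (polar_curve r t) phi.
Proof.
move=> pI t0; have [rp1 [rpp1 H]] := wedge_radius_derivatives.
pose rp q := Num.sqrt q.2 * rp1 q.1.
have st0 : 0 < Num.sqrt t by rewrite sqrtr_gt0.
have r0 (q : R) : 0 < q < beta -> 0 < r (q, t) by exact: (graph t t0).1.
have near_itv (q : R) : 0 < q < beta -> \forall x \near q, 0 < x < beta.
  move=> qI; have : q \in `]0, beta[ by rewrite in_itv.
  by move=> /near_in_itvoo; apply: filterS => x; rewrite in_itv.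
have drp (q s : R) : 0 < q < beta -> 0 < s -> is_derive q 1 (fun x => r (x, s)) (rp (q, s)).
  move=> qI s0; have [h _] := H q qI.
  have e : \forall x \near q, Num.sqrt s * r (x, 1) = r (x, s).
    by apply: filterS (near_itv q qI) => x xI; rewrite -self_similar_radius.
  by apply: near_is_derive e _; rewrite /rp /=; derive_tac; ring.
have drpp (q : R) : 0 < q < beta ->
    is_derive q 1 (fun x => rp (x, t)) (Num.sqrt t * rpp1 q).
  by move=> qI; have [_ h] := H q qI; rewrite /rp /=; derive_tac; ring.
have crp (q : R) : 0 < q < beta -> {for q, continuous (fun x => rp (x, t))}.
  by move=> qI; exact: is_derive_continuous (drpp q qI).
have crpJ : {for (phi, t), continuous rp}.
  have [_ h] := H phi pI; have h1 := is_derive_continuous _ _ _ h.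
  by rewrite /rp; cont_tac; exact: sqrt_continuous.
(* From [r (phi, s) = sqrt s * r (phi, 1)]. Then [r * r_t = r ^+ 2 / (2 * t)], and dividing by the
   speed gives the equality. *)
have drt : is_derive t 1 (fun s => r (phi, s)) (r (phi, t) / (2 * t)).
  have e : \forall s \near t, Num.sqrt s * r (phi, 1) = r (phi, s).
    by apply: filterS (lt_nbhsr t0) => s s0; rewrite -self_similar_radius.
  apply: near_is_derive e _; derive_tac => //.
  rewrite (self_similar_radius phi t pI t0).
  have := sqr_sqrtr (ltW t0); move: (Num.sqrt t) st0 => x x0 <-.
  by field; rewrite gt_eqF.
have [d dA] : exists d, is_derive phi 1 (fun x => atan (rp (x, t) / r (x, t))) d.
  have h1 := drp phi t pI t0; have h2 := drpp phi pI.
  eexists; derive_tac; last reflexivity.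
  by rewrite gt_eqF// r0.
have dr (q s : R) : 0 < q < beta -> 0 < s -> is_derive q 1 (fun x => r (x, s)) (rp (q, s)).
  exact: drp.
have evol := radial_evolution _ _ _ _ beta_bound graph flow rp phi t _ d pI t0 dr crpJ crp drt dA.
have drt' (q : R) : 0 < q < beta -> is_derive q 1 (fun x => r (x, t)) (rp (q, t)).
  by move=> qI; exact: drp.
rewrite (polar_curve_curvature _ _ _ _ _ r0 drt' crp _ _ pI dA) -evol.
rewrite (polar_curve_support _ _ _ _ _ drt' _ pI).
have s0 : 0 < Num.sqrt (r (phi, t) ^+ 2 + rp (phi, t) ^+ 2).
  by rewrite sqrtr_gt0 ltr_pwDl ?sqr_ge0// exprn_gt0// r0.
by field; rewrite !gt_eqF.
Qed.

End wedge.

Theorem corollary5p1 (R : realType) :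
  (forall (beta : R) (r : R * R -> R) (I : set R) (gamma : R * R -> R * R),
      0 < beta <= pi ->
      (forall phi t, 0 < phi < beta -> 0 <= t -> 0 < r (phi, t)) ->
      smooth_on (`]0, beta[ `*` `[0, +oo[) (r : R * R -> R^o) ->
      radial_coordinate_of beta I gamma r ->
      forall phi t, 0 < phi < beta -> 0 < t ->
        geodesic_curvature (polar_curve r t) phi
          <= 1 / (2 * t) * support_function (polar_curve r t) phi) /\
  (forall (beta : R) (I : set R) (gamma : R * R -> R * R) (r : R * R -> R),
      0 < beta < pi ->
      wedge_solution beta I gamma r ->
      forall phi t, 0 < phi < beta -> 0 < t ->
        geodesic_curvature (polar_curve r t) phi
          = 1 / (2 * t) * support_function (polar_curve r t) phi).
Proof.
split=> [beta r I gamma bI r0 sm rad|beta I gamma r /andP[b0 bpi] [[flow _] _ sim graph]].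
  exact: curvature_le_support bI r0 sm rad.
by apply: (wedge_curvature beta I gamma r _ graph flow sim); rewrite b0 ltW.
Qed.
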